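(* Let $\mathcal{R}$ be a representable signature. On well-typed representable terms over $\mathcal{R}$, the reduction $\to_{\mathsf{rep}} = \to_\beta \cup \to_\eta$ is confluent and strongly normalizing.
   Context: A representable signature consists of a set $\mathcal{A}$ of atoms and a multigraph $\mathcal{R}$ whose nodes (types) are generated by $a ::= o \in \mathcal{A} \mid (a_1 \otimes \cdots \otimes a_k)$ for $k \in \mathbb{N}$, with sets $\mathcal{R}(a_1,\dots,a_n;b)$ of multiarrows. Representable terms: $s,t ::= x \mid \langle s_1,\dots,s_k\rangle \mid s[x_1^{a_1},\dots,x_k^{a_k} := t] \mid f(s_1,\dots,s_n)$; in $s[\vec{x} := t]$ the $x_i$ are bound in $s$; terms up to renaming of bound variables. Typing rules: $x:a \vdash x:a$; if $f \in \mathcal{R}(a_1,\dots,a_n;b)$ and $\gamma_i \vdash s_i : a_i$ then $\gamma_1,\dots,\gamma_n \vdash f(s_1,\dots,s_n) : b$; if $\gamma_i \vdash s_i : a_i$ then $\gamma_1,\dots,\gamma_k \vdash \langle s_1,\dots,s_k\rangle : (a_1\otimes\cdots\otimes a_k)$; if $\gamma \vdash t : (a_1 \otimes\cdots\otimes a_k)$ and $\delta, x_1:a_1,\dots,x_k:a_k, \delta' \vdash s : b$ then $\delta,\gamma,\delta' \vdash s[x_1^{a_1},\dots,x_k^{a_k} := t] : b$; combined contexts are disjoint lists of distinct variables. Contexts with one hole: $\mathtt{C} ::= [\cdot] \mid \langle s_1,\dots,\mathtt{C},\dots,s_k\rangle \mid \mathtt{C}[\vec{x}:=t] \mid s[\vec{x}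 := \mathtt{C}] \mid f(s_1,\dots,\mathtt{C},\dots,s_n)$; $\mathtt{E}$ has the same grammar except that the clause $s[\vec{x} := \mathtt{E}]$ requires $\mathtt{E} \neq [\cdot]$; $\mathtt{L} ::= [\cdot] \mid \mathtt{L}[\vec{x} := t]$. $\mathsf{LT}$ is the set of terms $\mathtt{L}[\langle s_1,\dots,s_k\rangle]$. $\beta$: $s[x_1,\dots,x_k := \mathtt{L}[\langle t_1,\dots,t_k\rangle]] \to_\beta \mathtt{L}[s\{t_1/x_1,\dots,t_k/x_k\}]$ (capture-avoiding substitution), closed under $\mathtt{C}$-contexts. $\eta$: $s \to_\eta \langle x_1,\dots,x_k\rangle[x_1^{a_1},\dots,x_k^{a_k} := s]$ whenever $s$ has type $(a_1\otimes\cdots\otimes a_k)$, the $x_i$ are fresh and $s \notin \mathsf{LT}$; closed under $\mathtt{E}$-contexts. *)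

(* Defs.v *)
From Stdlib Require Import List Relation_Operators.
From mathcomp Require Import all_boot.

Set Implicit Arguments.
Unset Strict Implicit.
Unset Printing Implicit Defensive.

Inductive ty (A : Type) : Type :=
| Atom (o : A)
| Tens (l : seq (ty A)).

(* [marrow l b] is the set R(a_1, ..., a_n; b) for l = [:: a_1; ...; a_n]. *)
Record rep_sig : Type := RepSig {
  atom : Type;
  marrow : seq (ty atom) -> ty atom -> Type
}.

Notation rty R := (ty (atom R)).

(* Terms up to renaming of bound variables, in de Bruijn style.  The names of
   free variables are natural numbers.  [Let l s t] is
   s[x_1^{a_1}, ..., x_k^{a_k} := t] with l = [:: a_1; ...; a_k]: in s, the
   index i < k stands for x_{i+1}, and the index k + j for the variable j of
   the surrounding scope; t lives in the surrounding scope. *)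
Inductive term (R : rep_sig) : Type :=
| Var (x : nat)
| Tup (ss : seq (term R))
| Let (l : seq (rty R)) (s t : term R)
| App (l : seq (rty R)) (b : rty R) (f : marrow l b) (ss : seq (term R)).

Arguments Var {R} x.

Definition lift_ren (k : nat) (rho : nat -> nat) (i : nat) : nat :=
  if i < k then i else k + rho (i - k).

Fixpoint rename (R : rep_sig) (rho : nat -> nat) (s : term R) : term R :=
  match s with
  | Var x => Var (rho x)
  | Tup ss => Tup (map (rename rho) ss)
  | Let l s t => Let l (rename (lift_ren (size l) rho) s) (rename rho t)
  | App _ _ f ss => App f (map (rename rho) ss)
  end.

Definition lift_sub (R : rep_sig) (k : nat) (sigma : nat -> term R) (i : nat) :
  term R :=
  if i < k then Var i else rename (addn k) (sigma (i - k)).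

Fixpoint subst (R : rep_sig) (sigma : nat -> term R) (s : term R) : term R :=
  match s with
  | Var x => sigma x
  | Tup ss => Tup (map (subst sigma) ss)
  | Let l s t => Let l (subst (lift_sub (size l) sigma) s) (subst sigma t)
  | App _ _ f ss => App f (map (subst sigma) ss)
  end.

Definition cxt (R : rep_sig) : Type := seq (nat * rty R).

Definition distinct (R : rep_sig) (g : cxt R) : bool := uniq (map fst g).

(* x_1 : a_1, ..., x_k : a_k, as seen under the binder of x_1, ..., x_k. *)
Definition bound (R : rep_sig) (l : seq (rty R)) : cxt R :=
  zip (iota 0 (size l)) l.

(* A context seen from under a binder of k variables. *)
Definition shift (R : rep_sig) (k : nat) (g : cxt R) : cxt R :=
  [seq (k + p.1, p.2) | p <- g].

(* [typings g ss l] holds when g is the concatenation of contexts g_i with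
   g_i |- s_i : a_i. *)
Inductive typing (R : rep_sig) : cxt R -> term R -> rty R -> Prop :=
| T_Var x a : typing [:: (x, a)] (Var x) a
| T_App l b (f : marrow l b) g ss :
    typings g ss l -> distinct g -> typing g (App f ss) b
| T_Tup l g ss :
    typings g ss l -> distinct g -> typing g (Tup ss) (Tens l)
| T_Let l b d g d' s t :
    typing g t (Tens l) ->
    typing (shift (size l) d ++ bound l ++ shift (size l) d') s b ->
    distinct (d ++ g ++ d') ->
    typing (d ++ g ++ d') (Let l s t) b
with typings (R : rep_sig) : cxt R -> seq (term R) -> seq (rty R) -> Prop :=
| T_nil : typings [::] [::] [::]
| T_cons g g' s ss a l :
    typing g s a -> typings g' ss l -> typings (g ++ g') (s :: ss) (a :: l).

Inductive ctx (R : rep_sig) : Type :=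
| CHole
| CTup (ss : seq (term R)) (C : ctx R) (ss' : seq (term R))
| CBody (l : seq (rty R)) (C : ctx R) (t : term R)
| CArg (l : seq (rty R)) (s : term R) (C : ctx R)
| CApp (l : seq (rty R)) (b : rty R) (f : marrow l b)
    (ss : seq (term R)) (C : ctx R) (ss' : seq (term R)).

Arguments CHole {R}.

(* Plugging captures: the filling term is written in the scope of the hole. *)
Fixpoint fill (R : rep_sig) (C : ctx R) (u : term R) : term R :=
  match C with
  | CHole => u
  | CTup ss C ss' => Tup (ss ++ fill C u :: ss')
  | CBody l C t => Let l (fill C u) t
  | CArg l s C => Let l s (fill C u)
  | CApp _ _ f ss C ss' => App f (ss ++ fill C u :: ss')
  end.

Definition is_hole (R : rep_sig) (C : ctx R) : bool :=
  if C is CHole then true else false.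

Fixpoint is_E (R : rep_sig) (C : ctx R) : bool :=
  match C with
  | CHole => true
  | CTup _ C _ => is_E C
  | CBody _ C _ => is_E C
  | CArg _ _ C => ~~ is_hole C && is_E C
  | CApp _ _ _ _ C _ => is_E C
  end.

Fixpoint is_L (R : rep_sig) (C : ctx R) : bool :=
  match C with
  | CHole => true
  | CBody _ C _ => is_L C
  | _ => false
  end.

(* Number of variables bound by C at its hole. *)
Fixpoint depth (R : rep_sig) (C : ctx R) : nat :=
  match C with
  | CHole => 0
  | CTup _ C _ => depth C
  | CBody l C _ => depth C + size l
  | CArg _ _ C => depth C
  | CApp _ _ _ _ C _ => depth C
  end.

(* The typed variables in scope at the hole of C, when those of g are in scope
   outside C. *)
Fixpoint hole_scope (R : rep_sig) (C : ctx R) (g : cxt R) : cxt R :=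
  match C with
  | CHole => g
  | CTup _ C _ => hole_scope C g
  | CBody l C _ => hole_scope C (bound l ++ shift (size l) g)
  | CArg _ _ C => hole_scope C g
  | CApp _ _ _ _ C _ => hole_scope C g
  end.

Definition LT (R : rep_sig) (s : term R) : Prop :=
  exists L ts, is_L L /\ s = fill L (Tup ts).

(* s{t_1/x_1, ..., t_k/x_k}, where the t_i are written under d more binders
   than s[x_1, ..., x_k := _]; the other variables of s are shifted by d, so
   that these binders do not capture them. *)
Definition beta_subst (R : rep_sig) (d : nat) (ts : seq (term R)) (s : term R) :
  term R :=
  subst (fun i => if i < size ts then nth (Var 0) ts i
                  else Var (d + (i - size ts))) s.

Inductive beta_root (R : rep_sig) : term R -> term R -> Prop :=
| Beta_root l s L ts :
    is_L L -> size ts = size l ->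
    beta_root (Let l s (fill L (Tup ts))) (fill L (beta_subst (depth L) ts s)).

Inductive beta (R : rep_sig) : term R -> term R -> Prop :=
| Beta C s s' : beta_root s s' -> beta (fill C s) (fill C s').

Definition eta_expand (R : rep_sig) (l : seq (rty R)) (s : term R) : term R :=
  Let l (Tup (map Var (iota 0 (size l)))) s.

(* A raw term does not record the types of its free variables, so eta is
   relative to a context g typing the whole term.  The subterm s is then typed
   in a context h made of variables in scope at the hole. *)
Inductive eta (R : rep_sig) (g : cxt R) : term R -> term R -> Prop :=
| Eta E s l h :
    is_E E -> incl h (hole_scope E g) -> typing h s (Tens l) -> ~ LT s ->
    eta g (fill E s) (fill E (eta_expand l s)).

Definition rep (R : rep_sig) (g : cxt R) (s t : term R) : Prop :=
  beta s t \/ eta g s t.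

Definition confluent_at (T : Type) (red : T -> T -> Prop) (s : T) : Prop :=
  forall t u, clos_refl_trans T red s t -> clos_refl_trans T red s u ->
  exists v, clos_refl_trans T red t v /\ clos_refl_trans T red u v.

Definition SN (T : Type) (red : T -> T -> Prop) (s : T) : Prop :=
  Acc (fun y x => red x y) s.

(* Main.v *)
(** Beta fires only when the argument of a [Let] is in LT, and eta followed by
    beta simulates the commuting conversion
      Let m b (Let n s u)  -->  Let n (Let m b s) u
    when [s] is not in LT.  Each [Let] created around [b] is a new place where
    [b] can be expanded, so the number of expansions still possible has to
    account for all the [Let]s that the argument may bring.  This number is
    bounded by [val], a tree of counters that follows the nesting of tuples and
    that no reduction step increases; [cost] charges each body outside LT for
    that many expansions, and every step decreases it.  Linearity is used once,
    to see that the cost of a beta reduct is at most the sum of the costs.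

    Confluence follows by Newman's lemma.  In a critical pair the two reducts
    may differ by a root expansion, which is not allowed when they are the
    argument of a [Let]; but the redex formed by that [Let] then undoes the
    expansion.  Local confluence is therefore proved together with joinability
    under an enclosing [Let], and it does not depend on linearity. *)

From Stdlib Require Import Relation_Operators Operators_Properties.
Require Import Defs.
From mathcomp Require Import all_boot.
From mathcomp Require Import zify.

Set Implicit Arguments.
Unset Strict Implicit.
Unset Printing Implicit Defensive.

(** * Lists and reflexive transitive closures *)

Lemma eq_map_Forall T T' (f g : T -> T') (s : seq T) :
  List.Forall (fun x => f x = g x) s -> map f s = map g s.
Proof. by elim=> //= x s' -> _ ->. Qed.

Lemma Forall_imp T (P Q : T -> Prop) (s : seq T) :
  (forall x, P x -> Q x) -> List.Forall P s -> List.Forall Q s.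
Proof. by move=> PQ; elim; constructor; auto. Qed.

Lemma Forall_consP {T} {P : T -> Prop} {x} {s : seq T} :
  List.Forall P (x :: s) -> P x /\ List.Forall P s.
Proof. by move=> H; inversion H. Qed.

Lemma Forall_cat {T} {P : T -> Prop} {s1 s2 : seq T} :
  List.Forall P (s1 ++ s2) <-> List.Forall P s1 /\ List.Forall P s2.
Proof.
elim: s1 => [|x s1 IH] /=; first by split=> [|[]//]; split.
split=> [/Forall_consP[Px /IH[? ?]]|[/Forall_consP[Px H1] H2]].
  by split=> //; constructor.
by constructor=> //; apply/IH.
Qed.

Lemma Forall_map {T T'} {P : T' -> Prop} {f : T -> T'} {s : seq T} :
  List.Forall P (map f s) <-> List.Forall (fun x => P (f x)) s.
Proof.
elim: s => [|x s IH] /=; first by split; constructor.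
by split=> /Forall_consP[Px /IH H]; constructor.
Qed.

Lemma Forall_id_map T T' (P : T' -> Prop) (Q : T -> Prop)
    (f : T -> T') (s : seq T) :
  List.Forall (fun x => Q x -> P (f x)) s ->
  List.Forall id (map Q s) -> List.Forall id (map P (map f s)).
Proof.
elim=> [|x s' Px _ IH] /=; first by constructor.
by move=> H; inversion H; subst; constructor; [exact: Px|exact: IH].
Qed.

Lemma In_cat T (x : T) (s1 s2 : seq T) :
  List.In x (s1 ++ s2) <-> List.In x s1 \/ List.In x s2.
Proof. by elim: s1 => /= [|y s1 IH]; tauto. Qed.

Lemma In_map T T' (f : T -> T') x (s : seq T) :
  List.In x s -> List.In (f x) (map f s).
Proof. by elim: s => //= y s IH [->|/IH]; [left|right]. Qed.

Lemma inclP T (s1 s2 : seq T) :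
  List.incl s1 s2 <-> List.Forall (fun x => List.In x s2) s1.
Proof. by rewrite List.Forall_forall. Qed.

Lemma clos_refl_trans_map T T' (P : T -> T -> Prop) (Q : T' -> T' -> Prop)
    (h : T -> T') x y :
  (forall x y, P x y -> Q (h x) (h y)) ->
  clos_refl_trans T P x y -> clos_refl_trans T' Q (h x) (h y).
Proof.
move=> PQ; elim=> [{}x {}y /PQ|{}x|{}x {}y z _ IH1 _ IH2]; first exact: rt_step.
  exact: rt_refl.
exact: rt_trans IH1 IH2.
Qed.

(** * Substitution and the beta contractum *)

Section Syntax.
Variable R : rep_sig.
Implicit Types (s t u b c : term R) (ss ts : seq (term R)).

(** Terms are nested in lists, and the generated principle has no hypothesis on list members; the
    inner induction on the list, inside [fix], supplies it. *)
Lemma term_ind_nested (P : term R -> Prop) :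
  (forall x, P (Var x)) ->
  (forall ss, List.Forall P ss -> P (Tup ss)) ->
  (forall l s t, P s -> P t -> P (Let l s t)) ->
  (forall l a (f : marrow l a) ss, List.Forall P ss -> P (App f ss)) ->
  forall s, P s.
Proof.
move=> PV PT PL PA; fix IH 1 => -[x|ss|l s t|l a f ss].
- exact: PV.
- apply: PT; elim: ss => [|s ss IHss]; constructor => //; exact: IH.
- by apply: PL; exact: IH.
- apply: PA; elim: ss => [|s ss IHss]; constructor => //; exact: IH.
Qed.

(** Common form of what is carried under a binder of [k] variables: types in [ext], terms in [inst],
    values in [let_env]. One commutation with [lift_ren] then serves them all. *)
Definition cat_env (T : Type) (k : nat) (f rho : nat -> T) (i : nat) : T :=
  if i < k then f i else rho (i - k).

Lemma eq_cat_env T k (f f' rho rho' : nat -> T) :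
  (forall i, i < k -> f i = f' i) -> rho =1 rho' ->
  cat_env k f rho =1 cat_env k f' rho'.
Proof. by move=> ff' rr' i; rewrite /cat_env rr'; case: ltnP => // /ff'. Qed.

Lemma lift_ren_cat_env T k (f rho : nat -> T) r i :
  cat_env k f rho (lift_ren k r i) = cat_env k f (rho \o r) i.
Proof.
rewrite /cat_env /lift_ren; case: (ltnP i k) => [->//|_].
by rewrite ltnNge leq_addr /= addKn.
Qed.

Lemma cat_env_addn T k (f rho : nat -> T) i : cat_env k f rho (k + i) = rho i.
Proof. by rewrite /cat_env ltnNge leq_addr /= addKn. Qed.

Lemma lift_ren_inj k r : injective r -> injective (lift_ren k r).
Proof.
move=> r_inj i j; rewrite /lift_ren.
case: (ltnP i k) => ik; case: (ltnP j k) => jk E; try lia.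
have/r_inj : r (i - k) = r (j - k) by lia.
lia.
Qed.

(** * Composition laws of renaming and substitution *)

Lemma eq_rename r r' : r =1 r' -> @rename R r =1 rename r'.
Proof.
move=> rr' s; elim/term_ind_nested: s r r' rr' => //=.
- by move=> x r r' ->.
- move=> ss IH r r' rr'; congr Tup; apply: eq_map_Forall.
  by apply: Forall_imp IH => s; apply.
- move=> l s t IHs IHt r r' rr'; rewrite (IHt r r') //.
  by rewrite (IHs _ (lift_ren (size l) r')) // /lift_ren => i; rewrite rr'.
- move=> l a f ss IH r r' rr'; congr App; apply: eq_map_Forall.
  by apply: Forall_imp IH => s; apply.
Qed.

Lemma eq_subst sig sig' : sig =1 sig' -> @subst R sig =1 subst sig'.
Proof.
move=> rr' s; elim/term_ind_nested: s sig sig' rr' => //=.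
- move=> ss IH r r' rr'; congr Tup; apply: eq_map_Forall.
  by apply: Forall_imp IH => s; apply.
- move=> l s t IHs IHt r r' rr'; rewrite (IHt r r') //.
  by rewrite (IHs _ (lift_sub (size l) r')) // /lift_sub => i; rewrite rr'.
- move=> l a f ss IH r r' rr'; congr App; apply: eq_map_Forall.
  by apply: Forall_imp IH => s; apply.
Qed.

Lemma rename_as_subst r s : rename r s = subst (fun i => Var (r i)) s.
Proof.
elim/term_ind_nested: s r => //=.
- move=> ss IH r; congr Tup; apply: eq_map_Forall.
  by apply: Forall_imp IH => s; apply.
- move=> l s t IHs IHt r; rewrite IHt IHs; congr Let; apply: eq_subst => i.
  by rewrite /lift_sub /lift_ren; case: ifP.
- move=> l a f ss IH r; congr App; apply: eq_map_Forall.
  by apply: Forall_imp IH => s; apply.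
Qed.

Lemma subst_rename sig r s : subst sig (rename r s) = subst (sig \o r) s.
Proof.
elim/term_ind_nested: s sig r => //=.
- move=> ss IH sig r; rewrite -map_comp; congr Tup; apply: eq_map_Forall.
  by apply: Forall_imp IH => s; apply.
- move=> l s t IHs IHt sig r; rewrite IHt IHs; congr Let; apply: eq_subst => i.
  (* [lift_sub k sig] is convertible to [cat_env k Var (rename (addn k) \o sig)]. *)
  exact: (lift_ren_cat_env _ _ (rename _ \o sig)).
- move=> l a f ss IH sig r; rewrite -map_comp; congr App; apply: eq_map_Forall.
  by apply: Forall_imp IH => s; apply.
Qed.

Lemma rename_rename r r' s : rename r (rename r' s) = rename (r \o r') s.
Proof. by rewrite (rename_as_subst r) subst_rename (rename_as_subst (r \o r')).
  Qed.

Lemma rename_subst r sig s :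
  rename r (subst sig s) = subst (rename r \o sig) s.
Proof.
elim/term_ind_nested: s sig r => //=.
- move=> ss IH sig r; rewrite -map_comp; congr Tup; apply: eq_map_Forall.
  by apply: Forall_imp IH => s; apply.
- move=> l s t IHs IHt sig r; rewrite IHt IHs; congr Let; apply: eq_subst => i.
  rewrite /lift_sub /=; case: (ltnP i (size l)) => /= il;
    first by rewrite /lift_ren il.
  rewrite !rename_rename; apply: eq_rename => j /=.
  by rewrite /lift_ren ltnNge leq_addr /= addKn.
- move=> l a f ss IH sig r; rewrite -map_comp; congr App; apply: eq_map_Forall.
  by apply: Forall_imp IH => s; apply.
Qed.

Lemma subst_subst sig tau s :
  subst tau (subst sig s) = subst (subst tau \o sig) s.
Proof.
elim/term_ind_nested: s sig tau => //=.
- move=> ss IH sig tau; rewrite -map_comp; congr Tup; apply: eq_map_Forall.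
  by apply: Forall_imp IH => s; apply.
- move=> l s t IHs IHt sig tau; rewrite IHt IHs; congr Let; apply: eq_subst => i.
  rewrite /lift_sub /=; case: (ltnP i (size l)) => /= il; first by rewrite il.
  rewrite subst_rename rename_subst; apply: eq_subst => j /=.
  by rewrite ltnNge leq_addr /= addKn.
- move=> l a f ss IH sig tau; rewrite -map_comp; congr App; apply: eq_map_Forall.
  by apply: Forall_imp IH => s; apply.
Qed.

Lemma subst_Var s : subst Var s = s.
Proof.
elim/term_ind_nested: s => //=.
- move=> ss IH; rewrite -[RHS](congr1 _ (map_id ss)); congr Tup;
  exact: eq_map_Forall.
- move=> l s t IHs IHt; rewrite IHt; congr Let; rewrite -[RHS]IHs;
  apply: eq_subst => i.
  by rewrite /lift_sub /=; case: ltnP => // il; congr Var; lia.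
- move=> l a f ss IH; rewrite -[RHS](congr1 _ (map_id ss)); congr App;
  exact: eq_map_Forall.
Qed.

(* [Some k] when the term is L[<t_1, ..., t_k>]. *)
Fixpoint arity s : option nat :=
  match s with
  | Tup ss => Some (size ss)
  | Let _ s _ => arity s
  | _ => None
  end.

Definition isLT s : bool := arity s.

Lemma LTP s : reflect (LT s) (isLT s).
Proof.
apply: (iffP idP) => [|[L [ts [+ ->]]]]; last by elim: L.
elim/term_ind_nested: s => //=.
- by move=> ss _ _; exists CHole, ss.
- move=> l s t IH _ /IH [L [ts [LL ->]]]; by exists (CBody l L t), ts.
Qed.

Definition inst ts : nat -> term R := cat_env (size ts) (nth (Var 0) ts) Var.

(* The contractum of the redex [Let l b t], for t in LT and k = size l. *)
Fixpoint contract (k : nat) b t : term R :=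
  match t with
  | Tup ts => subst (inst ts) b
  | Let n s u => Let n (contract k (rename (lift_ren k (addn (size n))) b) s) u
  | _ => b
  end.

Lemma arity_rename r s : arity (rename r s) = arity s.
Proof. by elim/term_ind_nested: s r => //= ss _ r; rewrite size_map. Qed.

Lemma arity_subst sig s j : arity s = Some j -> arity (subst sig s) = Some j.
Proof.
elim/term_ind_nested: s sig => //= [ss _ sig|l s t IHs _ sig /IHs//].
by rewrite size_map.
Qed.

Lemma arity_contract k b t j k' :
  arity b = Some j -> arity t = Some k' -> arity (contract k b t) = Some j.
Proof.
elim/term_ind_nested: t b => //= [ts _|l s t IHs _] b bj;
  first by rewrite (arity_subst _ bj).
by apply: IHs; rewrite arity_rename.
Qed.

(** [contract] shifts [b] at each [Let] of [L], whereas [beta_subst] shifts once by [depth L]; the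
    shifts add up. *)
Lemma contract_fill L b ts : is_L L ->
  contract (size ts) b (fill L (Tup ts)) = fill L (beta_subst (depth L) ts b).
Proof.
elim: L b => //= l L IH t b.
move=> /IH ->; congr (Let _ (fill _ _) _); rewrite /beta_subst subst_rename.
apply: eq_subst => i /=; rewrite /lift_ren.
case: (ltnP i (size ts)) => it; first by rewrite it.
by rewrite ltnNge leq_addr /= addKn addnA.
Qed.

Lemma inst_lift ts sig i :
  subst (inst (map (subst sig) ts)) (lift_sub (size ts) sig i) =
  subst sig (inst ts i).
Proof.
rewrite /lift_sub /inst /cat_env; case: (ltnP i (size ts)) => it /=.
  by rewrite size_map it (nth_map (Var 0)).
rewrite subst_rename -[RHS]subst_Var; apply: eq_subst => j /=.
by rewrite size_map ltnNge leq_addr /= addKn.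
Qed.

(** The hypothesis makes the tuple at the core of [t] as long as the binder, so that lifting over
    [k] variables is lifting over exactly those that [inst] replaces. *)
Lemma subst_contract k sig b t : arity t = Some k ->
  subst sig (contract k b t) =
  contract k (subst (lift_sub k sig) b) (subst sig t).
Proof.
elim/term_ind_nested: t sig b => //= [ts _|l s t IHs _] sig b.
  by move=> [<-]; rewrite !subst_subst; apply: eq_subst => i /=;
    rewrite inst_lift.
move=> sk; congr Let; rewrite IHs //; congr contract.
rewrite subst_rename rename_subst; apply: eq_subst => i /=.
rewrite /lift_sub /lift_ren; case: (ltnP i k) => ik /=; first by rewrite !ik.
rewrite ltnNge leq_addr /= addKn ltnNge leq_addr /= addKn !rename_rename.
apply: eq_rename => j /=; rewrite ltnNge leq_addr /= addKn; lia.
Qed.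

Lemma rename_contract k r b t : arity t = Some k ->
  rename r (contract k b t) = contract k (rename (lift_ren k r) b) (rename r t).
Proof.
move=> tk; rewrite !rename_as_subst subst_contract //; congr contract.
by apply: eq_subst => i; rewrite /lift_sub /lift_ren; case: ifP.
Qed.

(** When the argument of a redex is itself a redex, the two can be contracted in either order: this
    closes the overlap of beta with itself. *)
Lemma contract_contract k m b s u : arity s = Some k -> arity u = Some m ->
  contract m (contract k (rename (lift_ren k (addn m)) b) s) u =
  contract k b (contract m s u).
Proof.
move=> + um; elim/term_ind_nested: u b s um => //= [us _|l v w IHv _] b s.
  move=> [<-] sk; rewrite subst_contract // subst_rename; congr contract.
  rewrite -[RHS]subst_Var; apply: eq_subst => i /=.
  rewrite /lift_sub /lift_ren; case: (ltnP i k) => ik; first by rewrite ik.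
  rewrite ltnNge leq_addr /= addKn /inst cat_env_addn /=; congr Var; lia.
move=> vm sk; congr Let; rewrite -IHv ?arity_rename // rename_contract //.
rewrite !rename_rename; congr (contract _ (contract _ _ _) _);
  apply: eq_rename => i /=.
rewrite /lift_ren; case: (ltnP i k) => ik; first by rewrite !ik.
by do ![rewrite ltnNge leq_addr /= addKn].
Qed.

Definition vars (k : nat) : seq (term R) := map Var (iota 0 k).

Lemma inst_vars k i : inst (vars k) i = Var (if i < k then i else i - k).
Proof.
rewrite /inst /cat_env size_map size_iota; case: ltnP => // ik.
by rewrite (nth_map 0) ?size_iota // nth_iota.
Qed.

(** Beta undoes an expansion whose argument lies in LT: all variables of the body are bound, so the
    renamings met along [t] leave it unchanged. *)
Lemma contract_vars k t : arity t = Some k -> contract k (Tup (vars k)) t = t.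
Proof.
have rv n : map (rename (lift_ren k n)) (vars k) = vars k.
  rewrite /vars -map_comp; apply/eq_in_map => i.
  by rewrite mem_iota /lift_ren /= add0n => ->.
elim/term_ind_nested: t => //= [ts _ [<-]|l s t IHs _ sk]; last by rewrite rv IHs.
congr Tup; rewrite /vars -map_comp -[in RHS](mkseq_nth (Var 0) ts).
apply/eq_in_map => i; rewrite mem_iota add0n /= /inst /cat_env => ->; by [].
Qed.

(** Beta undoes an expansion of the argument of a [Let]. An eta step allowed at that place would
    therefore create a loop. *)
Lemma contract_eta_expand (l : seq (rty R)) c s :
  contract (size l) c (eta_expand l s) = Let l c s.
Proof.
rewrite /= subst_rename; congr Let; rewrite -[RHS]subst_Var; apply: eq_subst => i.
rewrite -/(vars _) /= inst_vars /lift_ren; case: (ltnP i (size l)) => il;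
  first by rewrite !il.
by rewrite ltnNge leq_addr /= addKn; congr Var; lia.
Qed.
End Syntax.

(** * Local confluence *)

Section Reduction.
Variable R : rep_sig.
Implicit Types (s t u b c : term R) (ss ts : seq (term R)).
Implicit Types (Gam Del : nat -> rty R) (l : seq (rty R)).

(** * Typing by total environments *)

Definition ext l Gam : nat -> rty R :=
  cat_env (size l) (nth (Tens [::]) l) Gam.

(** The annotations on [Let] and [App] determine the type once every variable has one. Together with
    [wt] this is a typing without linearity; it suffices for local confluence and requires no
    splitting of contexts. *)
Fixpoint tyof Gam s : rty R :=
  match s with
  | Var x => Gam x
  | Tup ss => Tens (map (tyof Gam) ss)
  | Let l s _ => tyof (ext l Gam) s
  | App _ b _ _ => b
  end.

Fixpoint wt Gam s : Prop :=
  match s with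
  | Var x => True
  | Tup ss => List.Forall id (map (wt Gam) ss)
  | Let l s t => [/\ wt (ext l Gam) s, wt Gam t & tyof Gam t = Tens l]
  | App l _ _ ss => List.Forall id (map (wt Gam) ss) /\ map (tyof Gam) ss = l
  end.

Lemma tyof_rename Gam Del r s : (forall x, Del (r x) = Gam x) ->
  tyof Del (rename r s) = tyof Gam s.
Proof.
elim/term_ind_nested: s Gam Del r => //= [ss IH|l s t IHs _] Gam Del r GD.
  rewrite -map_comp; congr Tens; apply: eq_map_Forall.
  by apply: Forall_imp IH => s /=; apply.
apply: IHs => x; rewrite /ext lift_ren_cat_env; exact: eq_cat_env.
Qed.

Lemma wt_rename Gam Del r s : (forall x, Del (r x) = Gam x) ->
  wt Gam s -> wt Del (rename r s).
Proof.
elim/term_ind_nested: s Gam Del r =>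
  //= [ss IH|l s t IHs IHt|l a f ss IH] Gam Del r GD.
- by apply: Forall_id_map; apply: Forall_imp IH => s /= IH; apply: IH.
- case=> ws wt_t tt; split; last by rewrite (tyof_rename _ GD).
    apply: IHs ws => x; rewrite /ext lift_ren_cat_env; exact: eq_cat_env.
  exact: IHt wt_t.
- case=> ws <-; split.
    by move: ws; apply: Forall_id_map; apply: Forall_imp IH => s /= IH; apply: IH.
  rewrite -map_comp; apply: eq_map => s /=; exact: tyof_rename.
Qed.

Definition wt_sub Gam Del (sig : nat -> term R) : Prop :=
  forall x, wt Del (sig x) /\ tyof Del (sig x) = Gam x.

Lemma wt_sub_lift Gam Del sig l : wt_sub Gam Del sig ->
  wt_sub (ext l Gam) (ext l Del) (lift_sub (size l) sig).
Proof.
move=> ws x; rewrite /lift_sub; case: (ltnP x (size l)) => xl /=.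
  by rewrite /ext /cat_env xl.
have -> : ext l Gam x = Gam (x - size l) by rewrite /ext /cat_env ltnNge xl.
have E y : ext l Del (size l + y) = Del y by rewrite /ext cat_env_addn.
have [w <-] := ws (x - size l); split; first exact: wt_rename w.
exact: tyof_rename.
Qed.

Lemma tyof_subst Gam Del sig s : wt_sub Gam Del sig ->
  tyof Del (subst sig s) = tyof Gam s.
Proof.
elim/term_ind_nested: s Gam Del sig => //= [x|ss IH|l s t IHs _] Gam Del sig GD.
- by have [] := GD x.
- rewrite -map_comp; congr Tens; apply: eq_map_Forall.
  by apply: Forall_imp IH => s /=; apply.
- exact/IHs/wt_sub_lift.
Qed.

Lemma wt_subst Gam Del sig s : wt_sub Gam Del sig ->
  wt Gam s -> wt Del (subst sig s).
Proof.
elim/term_ind_nested: s Gam Del sig =>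
  //= [x|ss IH|l s t IHs IHt|l a f ss IH] Gam Del sig GD.
- by have [] := GD x.
- by apply: Forall_id_map; apply: Forall_imp IH => s /= IH; apply: IH.
- case=> ws wt_t tt; split; last by rewrite (tyof_subst _ GD).
    by apply: IHs ws; apply: wt_sub_lift.
  exact: IHt wt_t.
- case=> ws <-; split.
    by move: ws; apply: Forall_id_map; apply: Forall_imp IH => s /= IH; apply: IH.
  rewrite -map_comp; apply: eq_map => s /=; exact: tyof_subst.
Qed.

Lemma wt_sub_inst Gam ts : List.Forall id (map (wt Gam) ts) ->
  wt_sub (ext (map (tyof Gam) ts) Gam) Gam (inst ts).
Proof.
move=> H x; rewrite /ext /inst /cat_env size_map.
case: ltnP => // xt; rewrite (nth_map (Var 0)) //; split=> //.
elim: ts H x xt => //= t ts IH H; inversion H; subst.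
by move=> [|x] //= /IH; apply.
Qed.

Lemma arity_tyof Gam l s : isLT s -> tyof Gam s = Tens l ->
  arity s = Some (size l).
Proof.
rewrite /isLT; elim/term_ind_nested: s Gam =>
  //= [ss _ Gam _ [<-]|l' s t IHs _ Gam].
  by rewrite size_map.
exact: IHs.
Qed.

Lemma ext_lift l n Gam x :
  ext l (ext n Gam) (lift_ren (size l) (addn (size n)) x) = ext l Gam x.
Proof.
rewrite /ext lift_ren_cat_env; apply: eq_cat_env => // y /=.
exact: cat_env_addn.
Qed.

Lemma wt_contract Gam l b t : arity t = Some (size l) ->
  wt (ext l Gam) b -> wt Gam t -> tyof Gam t = Tens l ->
  wt Gam (contract (size l) b t) /\
  tyof Gam (contract (size l) b t) = tyof (ext l Gam) b.
Proof.
elim/term_ind_nested: t Gam b => //= [ts _|n s u IHs _] Gam b.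
  move=> _ wb wts [El]; rewrite -El in wb *.
  by have W := wt_sub_inst wts; split; [exact: wt_subst wb|exact: tyof_subst].
move=> sl wb [ws wu tu] ts; have E := @ext_lift l n Gam.
have [w ->] := IHs _ _ sl (wt_rename E wb) ws ts.
by rewrite (tyof_rename _ E).
Qed.

(** * One-step reduction, its inversion and its stability *)

Inductive one_step (P : term R -> term R -> Prop) :
  seq (term R) -> seq (term R) -> Prop :=
| One_hd s s' ss : P s s' -> one_step P (s :: ss) (s' :: ss)
| One_tl s ss ss' : one_step P ss ss' -> one_step P (s :: ss) (s :: ss').

(* The flag [e] tells whether eta may act at the root: it may not when the
   term is the argument of a [Let]. *)
Inductive step (e : bool) Gam : term R -> term R -> Prop :=
| S_beta l b t : arity t = Some (size l) ->
    step e Gam (Let l b t) (contract (size l) b t)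
| S_eta l s : e -> tyof Gam s = Tens l -> ~~ isLT s ->
    step e Gam s (eta_expand l s)
| S_tup ss ss' : one_step (step true Gam) ss ss' ->
    step e Gam (Tup ss) (Tup ss')
| S_app l a (f : marrow l a) ss ss' : one_step (step true Gam) ss ss' ->
    step e Gam (App f ss) (App f ss')
| S_body l b b' t : step true (ext l Gam) b b' ->
    step e Gam (Let l b t) (Let l b' t)
| S_arg l b t t' : step false Gam t t' ->
    step e Gam (Let l b t) (Let l b t').

Lemma step_inv e Gam s s' : step e Gam s s' ->
  (exists l, [/\ e, tyof Gam s = Tens l, ~~ isLT s & s' = eta_expand l s]) \/
  match s with
  | Var _ => False
  | Tup ss => exists2 ss', one_step (step true Gam) ss ss' & s' = Tup ss'
  | App l a f ss => exists2 ss', one_step (step true Gam) ss ss' & s' = App f ss'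
  | Let l b t =>
      [\/ arity t = Some (size l) /\ s' = contract (size l) b t,
          exists2 b', step true (ext l Gam) b b' & s' = Let l b' t |
          exists2 t', step false Gam t t' & s' = Let l b t']
  end.
Proof.
case: s s' /.
- by move=> l b t tl; right; constructor 1.
- by move=> l s e1 ts ns; left; exists l.
- by move=> ss ss' H; right; exists ss'.
- by move=> l a f ss ss' H; right; exists ss'.
- by move=> l b b' t H; right; constructor 2; exists b'.
- by move=> l b t t' H; right; constructor 3; exists t'.
Qed.

Lemma step_false Gam e s s' : step false Gam s s' -> step e Gam s s'.
Proof. by case: s s' /; intros; econstructor; eauto. Qed.

Lemma step_true Gam e s s' : step e Gam s s' -> step true Gam s s'.
Proof. by case: e => // /step_false; apply. Qed.

Lemma step_eta_or_false e Gam s s' : step e Gam s s' ->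
  step false Gam s s' \/
  exists l, [/\ tyof Gam s = Tens l, ~~ isLT s & s' = eta_expand l s].
Proof.
case: s s' / => [l b t H|l s _ ts ns|ss ss' H|l a f ss ss' H|l b b' t H|l b t
  t' H].
- by left; apply: S_beta.
- by right; exists l.
- by left; apply: S_tup.
- by left; apply: S_app.
- by left; apply: S_body.
- by left; apply: S_arg.
Qed.

Lemma one_step_map (P Q : term R -> term R -> Prop)
    (h : term R -> term R) ss ss' :
  List.Forall (fun s => forall s', P s s' -> Q (h s) (h s')) ss ->
  one_step P ss ss' -> one_step Q (map h ss) (map h ss').
Proof.
move=> + H; elim: ss ss' / H => [s s' ss Pss|s ss ss' _ IH] H; inversion H; subst.
  by constructor; auto.
by constructor 2; auto.
Qed.

Lemma one_step_size (P : term R -> term R -> Prop) ss ss' :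
  one_step P ss ss' -> size ss' = size ss.
Proof. by elim=> //= s ss1 ss2 _ ->. Qed.

(** A term in LT has no root expansion, and every other step keeps the length of its core tuple. *)
Lemma arity_step e Gam s s' j : arity s = Some j -> step e Gam s s' ->
  arity s' = Some j.
Proof.
elim/term_ind_nested: s e Gam s' => //= [ss _|l s t IHs _] e Gam s'.
  move=> sj /step_inv[[l [_ _]]|[ss' /one_step_size E ->]] //=.
  by rewrite E.
move=> sj /step_inv[[l' [_ _]]|[[tl ->]|[b' + ->]|[t' _ ->]]] //=.
- by rewrite /isLT /= sj.
- exact: arity_contract sj tl.
- exact: IHs.
Qed.

Lemma isLT_step e Gam s s' : isLT s -> step e Gam s s' -> isLT s'.
Proof.
by rewrite /isLT; case E: (arity s) => [j|//] _ /(arity_step E) ->.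
Qed.

Lemma LT_step e Gam s s' : isLT s -> step e Gam s s' -> step false Gam s s'.
Proof.
move=> LTs; case: e => // H.
case: s s' / H LTs =>
  [l b t tl|l u _ _ /negbTE ->|ss ss' H|l a f ss ss' H|l b b' t H|l b t t' H]
    // _.
- exact: S_beta.
- exact: S_tup.
- exact: S_body.
- exact: S_arg.
Qed.

Lemma wt_vars Gam l : List.Forall id (map (wt (ext l Gam)) (vars R (size l))).
Proof. by rewrite /vars; elim: (iota _ _) => [|n s IH]; constructor. Qed.

Lemma tyof_vars Gam l : map (tyof (ext l Gam)) (vars R (size l)) = l.
Proof.
rewrite -map_comp -[RHS](mkseq_nth (Tens [::]) l); apply/eq_in_map => i.
by rewrite mem_iota /= add0n /ext /cat_env => ->.
Qed.

Lemma wt_one_step Gam ss ss' :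
  List.Forall (fun s => forall s', wt Gam s -> step true Gam s s' ->
     wt Gam s' /\ tyof Gam s' = tyof Gam s) ss ->
  List.Forall id (map (wt Gam) ss) -> one_step (step true Gam) ss ss' ->
  List.Forall id (map (wt Gam) ss') /\ map (tyof Gam) ss' = map (tyof Gam) ss.
Proof.
move=> + + H; elim: ss ss' / H => [s s' ss Pss|s ss ss' _ IH] H1 H2;
  inversion H1; inversion H2; subst => /=.
  by have [w ->] := H3 _ H7 Pss; split=> //; constructor.
by have [w ->] := IH H4 H8; split=> //; constructor.
Qed.

Lemma wt_step e Gam s s' : wt Gam s -> step e Gam s s' ->
  wt Gam s' /\ tyof Gam s' = tyof Gam s.
Proof.
have wt_eta Del u l : wt Del u -> tyof Del u = Tens l ->
    wt Del (eta_expand l u) /\ tyof Del (eta_expand l u) = tyof Del u.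
  move=> wu tu; rewrite /= -/(vars R _) tyof_vars tu; split=> //; split=> //.
  exact: wt_vars.
elim/term_ind_nested: s e Gam s' =>
  //= [x|ss IH|l s t IHs IHt|l a f ss IH] e Gam s'.
- by move=> _ /step_inv[[l [_ tl _ ->]]|//]; apply: wt_eta.
- move=> ws /step_inv[[l [_ tl _ ->]]|[ss' H ->]]; first exact: wt_eta.
  have [|w E] := wt_one_step _ ws H; last by rewrite /= E.
  by apply: Forall_imp IH => u IHu u'; apply: IHu.
- move=> W; have [ws w_t tt] := W.
  move=> /step_inv[[l' [_ tl _ ->]]|[[tl ->]|[b' H ->]|[t' H ->]]];
    first exact: wt_eta.
  + exact: wt_contract.
  + by have [w E] := IHs _ _ _ ws H; rewrite /= E.
  + by have [w E] := IHt _ _ _ w_t H; rewrite /= E.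
- move=> W; have [ws E] := W.
  move=> /step_inv[[l' [_ tl _ ->]]|[ss' H ->]]; first exact: wt_eta.
  have [|w E'] := wt_one_step _ ws H; last by rewrite /= E'.
  by apply: Forall_imp IH => u IHu u'; apply: IHu.
Qed.

Lemma step_rename e Gam Del r s s' : (forall x, Del (r x) = Gam x) ->
  step e Gam s s' -> step e Del (rename r s) (rename r s').
Proof.
have ren_eta q l u : rename q (eta_expand l u) = eta_expand l (rename q u).
  rewrite /= -map_comp; congr (Let _ (Tup _) _); apply/eq_in_map => i.
  by rewrite mem_iota /lift_ren /= add0n => ->.
elim/term_ind_nested: s e Gam Del r s' =>
  /= [x|ss IH|l s t IHs IHt|l a f ss IH] e Gam Del r s' GD.
- by move=> /step_inv[[l [e1 tl nl ->]]|//]; rewrite ren_eta; constructor;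
  rewrite //= GD.
- move=> /step_inv[[l [_ tl //]]|[ss' H ->]]; constructor.
  by apply: one_step_map H; apply: Forall_imp IH => u IHu u'; apply: IHu.
- move=> /step_inv[[l' [e1 tl nl ->]]|[[tl ->]|[b' H ->]|[t' H ->]]].
  + rewrite ren_eta; apply: S_eta; rewrite // ?(tyof_rename (Let l s t) GD) //.
    by rewrite /isLT (arity_rename r (Let l s t)).
  + by rewrite rename_contract //; apply: S_beta; rewrite arity_rename.
  + apply: S_body; apply: IHs H => x.
    by rewrite /ext lift_ren_cat_env; apply: eq_cat_env.
  + by apply: S_arg; apply: IHt H.
- move=> /step_inv[[l' [e1 tl nl ->]]|[ss' H ->]];
    first by rewrite ren_eta; constructor.
  constructor; apply: one_step_map H.
  by apply: Forall_imp IH => u IHu u'; apply: IHu.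
Qed.

Lemma subst_eta_expand sig l u :
  subst sig (eta_expand l u) = eta_expand l (subst sig u).
Proof.
rewrite /= -map_comp; congr (Let _ (Tup _) _); apply/eq_in_map => i.
by rewrite mem_iota /lift_sub /= add0n => ->.
Qed.

Lemma step_eta_LT e Gam l u : isLT u -> tyof Gam u = Tens l ->
  step e Gam (eta_expand l u) u.
Proof.
move=> LTu tu; have au := arity_tyof LTu tu.
by rewrite -[X in step _ _ _ X](contract_vars au); apply: S_beta.
Qed.

(* A substitution may turn the source of an eta step into a term of LT; the
   step is then inverted by beta. *)
Definition step_or_inv e Gam s t := step e Gam s t \/ step e Gam t s.

Lemma step_subst_eta (e : bool) Gam Del sig l s : wt_sub Gam Del sig ->
  e -> tyof Gam s = Tens l ->
  step_or_inv e Del (subst sig s) (subst sig (eta_expand l s)).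
Proof.
move=> W e1; rewrite -(tyof_subst _ W) subst_eta_expand => tl.
case LTu: (isLT (subst sig s)); last by left; constructor; rewrite ?LTu.
by right; apply: step_eta_LT.
Qed.

Lemma one_step_subst Gam Del sig ss ss' :
  List.Forall id (map (wt Gam) ss) ->
  List.Forall (fun s => forall s', wt Gam s -> step true Gam s s' ->
    step_or_inv true Del (subst sig s) (subst sig s')) ss ->
  one_step (step true Gam) ss ss' ->
  one_step (step true Del) (map (subst sig) ss) (map (subst sig) ss') \/
  one_step (step true Del) (map (subst sig) ss') (map (subst sig) ss).
Proof.
move=> + + H; elim: ss ss' / H => [t t' ss Pss|t ss ss' _ IH] H1 H2;
  inversion H1; inversion H2; subst => /=.
  by case: (H7 _ H3 Pss); [left|right]; constructor.
by case: (IH H4 H8); [left|right]; constructor.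
Qed.

Lemma step_subst e Gam Del sig s s' : wt_sub Gam Del sig -> wt Gam s ->
  step e Gam s s' -> step_or_inv e Del (subst sig s) (subst sig s').
Proof.
elim/term_ind_nested: s e Gam Del sig s'
  => [x|ss IH|l s t IHs IHt|l a f ss IH] e Gam Del sig s' W.
- by move=> _ /step_inv[[l [e1 tl _ ->]]|//]; apply: (step_subst_eta W).
- move=> ws /step_inv[[l [e1 tl _ ->]]|[ss' H ->]];
  first exact: (step_subst_eta W).
  have IH' := Forall_imp (fun u IHu u' => IHu true Gam Del sig u' W) IH.
  have [H'|H'] := one_step_subst ws IH' H.
  + by left; constructor.
  + by right; constructor.
- move=> [ws w_t tt] /step_inv[[l' [e1 tl _ ->]]|[[tl ->]|[b' H ->]|[t' H ->]]].
  + exact: (step_subst_eta W).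
  + by left; rewrite subst_contract //; constructor; apply: arity_subst.
  + by case: (IHs _ _ _ _ _ (wt_sub_lift _ W) ws H); [left|right]; constructor.
  + by case: (IHt _ _ _ _ _ W w_t H); [left|right]; constructor.
- move=> [ws E] /step_inv[[l' [e1 tl _ ->]]|[ss' H ->]];
  first exact: (step_subst_eta W).
  have IH' := Forall_imp (fun u IHu u' => IHu true Gam Del sig u' W) IH.
  have [H'|H'] := one_step_subst ws IH' H.
  + by left; constructor.
  + by right; constructor.
Qed.

(** * Joinability *)

Definition steps e Gam := clos_refl_trans (term R) (step e Gam).
Definition one_steps Gam := clos_refl_trans _ (one_step (step true Gam)).

Definition joinable e Gam s t := exists2 v, steps e Gam s v & steps e Gam t v.

Lemma joinable_refl e Gam s : joinable e Gam s s.
Proof. by exists s; apply: rt_refl. Qed.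

Lemma joinable_sym e Gam s t : joinable e Gam s t -> joinable e Gam t s.
Proof. by case=> v sv tv; exists v. Qed.

Lemma joinable_step e Gam s t : step e Gam s t -> joinable e Gam s t.
Proof. by exists t; [apply: rt_step|apply: rt_refl]. Qed.

Lemma joinable_stepr e Gam s t t' :
  joinable e Gam s t' -> step e Gam t t' -> joinable e Gam s t.
Proof.
by case=> v sv tv tt'; exists v => //; apply: rt_trans tv; apply: rt_step.
Qed.

Lemma joinable_map e e' Gam Del h s t :
  (forall x y, step e Gam x y -> step e' Del (h x) (h y)) ->
  joinable e Gam s t -> joinable e' Del (h s) (h t).
Proof.
by move=> H [v sv tv]; exists (h v); apply: clos_refl_trans_map (H) _.
Qed.

Lemma joinable_false Gam e s t : joinable false Gam s t -> joinable e Gam s t.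
Proof. by apply: (joinable_map (h := id)) => x y; apply: step_false. Qed.

(* A root expansion of [s] cannot be matched when [s] is the argument of a
   [Let], but then it is undone by beta; hence the second clause. *)
Definition joinable_arg Gam s t : Prop :=
  [/\ tyof Gam t = tyof Gam s, joinable true Gam s t &
      forall l c, tyof Gam s = Tens l ->
        joinable false Gam (Let l c s) (Let l c t)].

Lemma joinable_arg_sym Gam s t : joinable_arg Gam s t -> joinable_arg Gam t s.
Proof.
case=> E J1 J2; split=> //; first exact: joinable_sym.
by move=> l c; rewrite E => tl; apply/joinable_sym/J2.
Qed.

Lemma joinable_joinable_arg Gam s t : tyof Gam t = tyof Gam s ->
  joinable false Gam s t -> joinable_arg Gam s t.
Proof.
move=> E J; split=> //; first exact: joinable_false.
by move=> l c _; apply: joinable_map J => x y; apply: S_arg.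
Qed.

Lemma joinable_arg_refl Gam s : joinable_arg Gam s s.
Proof. exact/joinable_joinable_arg/joinable_refl. Qed.

Lemma joinable_arg_stepr Gam s t t' : wt Gam t ->
  joinable_arg Gam s t' -> step false Gam t t' -> joinable_arg Gam s t.
Proof.
move=> w [E J1 J2] st; split; first by rewrite -E; case: (wt_step w st).
  by apply: joinable_stepr J1 _; apply: step_false.
by move=> l c /J2 J; apply: joinable_stepr (J c) _; apply: S_arg.
Qed.

Lemma joinable_arg_step e Gam s t :
  wt Gam s -> step e Gam s t -> joinable_arg Gam s t.
Proof.
move=> w st; have [_ E] := wt_step w st; split=> //.
  exact/joinable_step/(step_true st).
move=> l c tl; case: (step_eta_or_false st) => [st'|[l' []]].
  by apply: joinable_step; apply: S_arg.
(* The step is a root expansion: the enclosing [Let] contracts back to the [Let] on the source. *)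
rewrite tl => -[<-] ns ->; apply: joinable_sym; apply: joinable_step.
rewrite -[X in step _ _ _ X]contract_eta_expand; apply: S_beta.
by rewrite /= size_map size_iota.
Qed.

Lemma joinable_steps e Gam s s' t t' :
  steps e Gam s s' -> steps e Gam t t' -> joinable e Gam s' t' ->
  joinable e Gam s t.
Proof. by move=> ss tt [v sv tv]; exists v; apply: rt_trans; eauto. Qed.

(** Both bodies are first reduced to a common [v], because the clause of [joinable_arg] about an
    enclosing [Let] has the same body on both sides. *)
Lemma joinable_Let e Gam l b b' t t' : tyof Gam t = Tens l ->
  joinable true (ext l Gam) b b' -> joinable_arg Gam t t' ->
  joinable e Gam (Let l b t) (Let l b' t').
Proof.
move=> tl [v bv b'v] [_ _ /(_ l v tl) J]; apply: joinable_false.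
apply: joinable_steps J.
  by apply: (clos_refl_trans_map (h := fun b => Let l b t)) bv => x y;
    apply: S_body.
by apply: (clos_refl_trans_map (h := fun b => Let l b t')) b'v => x y;
  apply: S_body.
Qed.

Definition joinables Gam ss ss' :=
  exists2 vs, one_steps Gam ss vs & one_steps Gam ss' vs.

Lemma joinables_refl Gam ss : joinables Gam ss ss.
Proof. by exists ss; apply: rt_refl. Qed.

Lemma one_steps_cons Gam s s' ss ss' :
  steps true Gam s s' -> one_steps Gam ss ss' ->
  one_steps Gam (s :: ss) (s' :: ss').
Proof.
move=> H H'; apply: (@rt_trans _ _ _ (s' :: ss)).
  by apply: (clos_refl_trans_map (h := cons^~ ss)) H => x y; apply: One_hd.
by apply: (clos_refl_trans_map (h := cons s')) H' => x y; apply: One_tl.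
Qed.

Lemma joinables_cons Gam s s' ss ss' :
  joinable true Gam s s' -> joinables Gam ss ss' ->
  joinables Gam (s :: ss) (s' :: ss').
Proof. by case=> v ? ? [vs ? ?]; exists (v :: vs); apply: one_steps_cons. Qed.

Lemma joinables_Tup e Gam ss ss' :
  joinables Gam ss ss' -> joinable e Gam (Tup ss) (Tup ss').
Proof.
by case=> v H H'; exists (Tup v); apply: clos_refl_trans_map H ||
  apply: clos_refl_trans_map H' => x y; apply: S_tup.
Qed.

Lemma joinables_App e Gam l a (f : marrow l a) ss ss' :
  joinables Gam ss ss' -> joinable e Gam (App f ss) (App f ss').
Proof.
by case=> v H H'; exists (App f v); apply: clos_refl_trans_map H ||
  apply: clos_refl_trans_map H' => x y; apply: S_app.
Qed.

Lemma lift_sub_step l Gam (sig sig' : nat -> term R) :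
  (forall x, sig x = sig' x \/ step true Gam (sig x) (sig' x)) ->
  forall x, lift_sub (size l) sig x = lift_sub (size l) sig' x \/
    step true (ext l Gam) (lift_sub (size l) sig x) (lift_sub (size l) sig' x).
Proof.
move=> H x; rewrite /lift_sub; case: ltnP => _; first by left.
case: (H (x - size l)) => [->|st]; [by left|right].
by apply: step_rename st => y; rewrite /ext cat_env_addn.
Qed.

Lemma joinable_arg_subst Gam Del sig sig' b :
  wt_sub Gam Del sig -> wt_sub Gam Del sig' ->
  (forall x, sig x = sig' x \/ step true Del (sig x) (sig' x)) ->
  wt Gam b -> joinable_arg Del (subst sig b) (subst sig' b).
Proof.
have lists G D sg sg' ss : wt_sub G D sg -> wt_sub G D sg' ->
    (forall x, sg x = sg' x \/ step true D (sg x) (sg' x)) ->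
    List.Forall id (map (wt G) ss) ->
    List.Forall (fun b => forall Gam Del sig sig',
      wt_sub Gam Del sig -> wt_sub Gam Del sig' ->
      (forall x, sig x = sig' x \/ step true Del (sig x) (sig' x)) ->
      wt Gam b -> joinable_arg Del (subst sig b) (subst sig' b)) ss ->
    joinables D (map (subst sg) ss) (map (subst sg') ss).
  move=> W W' H; elim: ss => [|s ss IH] H1 H2; first exact: joinables_refl.
  inversion H1; inversion H2; subst; apply: joinables_cons; last exact: IH.
  by have [] := H8 _ _ _ _ W W' H H4.
elim/term_ind_nested: b Gam Del sig sig' =>
  [x|ss IH|l s t IHs IHt|l a f ss IH] Gam Del sig sig' W W' H.
- move=> _ /=; case: (H x) => [->|]; first exact: joinable_arg_refl.
  by apply: joinable_arg_step; case: (W x).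
- move=> wss; apply: joinable_joinable_arg; first by rewrite !(tyof_subst _ W,
  tyof_subst _ W').
  by apply: joinables_Tup; apply: lists W W' H wss IH.
- move=> [ws w_t tl]; apply: joinable_joinable_arg;
  first by rewrite !(tyof_subst _ W, tyof_subst _ W').
  apply: joinable_Let; first by rewrite (tyof_subst _ W).
    have [] // := IHs _ _ _ _ (wt_sub_lift l W) (wt_sub_lift l W') _ ws.
    exact: lift_sub_step.
  exact: IHt W W' H w_t.
- move=> [wss _]; apply: joinable_joinable_arg;
  first by rewrite !(tyof_subst _ W, tyof_subst _ W').
  by apply: joinables_App; apply: lists W W' H wss IH.
Qed.

(** * Critical pairs *)

Lemma joinable_arg_contract_body Gam l b b' t :
  arity t = Some (size l) -> wt Gam t -> tyof Gam t = Tens l ->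
  wt (ext l Gam) b -> step true (ext l Gam) b b' ->
  joinable_arg Gam (contract (size l) b t) (contract (size l) b' t).
Proof.
elim/term_ind_nested: t Gam b b' => //= [ts _|n s u IHs _] Gam b b'.
  move=> _ wts [tl] wb st; have [wb' _] := wt_step wb st.
  have W := wt_sub_inst wts; rewrite tl in W.
  (* Substitution may reverse the step, but joinability is symmetric. *)
  case: (step_subst W wb st) => st'; last apply: joinable_arg_sym;
    by apply: joinable_arg_step st'; apply: wt_subst W _.
move=> sl [ws wu tu] tl wb st; have E := @ext_lift l n Gam.
have [|T J _] := IHs _ _ _ sl ws tl _ (step_rename E st);
  first exact: wt_rename wb.
apply: joinable_joinable_arg => //; apply: joinable_Let => //.
exact: joinable_arg_refl.
Qed.

Lemma one_step_nth (P : term R -> term R -> Prop) d ss ss' x :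
  one_step P ss ss' -> nth d ss x = nth d ss' x \/ P (nth d ss x) (nth d ss' x).
Proof.
move=> H; elim: ss ss' / H x => [s s' ss H|s ss ss' _ IH] [|x] /=;
  by [left|right|].
Qed.

Lemma joinable_arg_contract_arg Gam l b t t' :
  arity t = Some (size l) -> wt Gam t -> tyof Gam t = Tens l ->
  wt (ext l Gam) b -> step false Gam t t' ->
  joinable_arg Gam (contract (size l) b t) (contract (size l) b t').
Proof.
elim/term_ind_nested: t Gam b t' => // [ts _|n s u IHs _] Gam b t'.
  move=> _ wts [tl] wb st.
  case: (step_inv st) => [[? []]//|[ts' H D]]; subst t'.
  have [wts' [tts']] := wt_step wts st.
  have W := wt_sub_inst wts; have W' := wt_sub_inst wts'.
  rewrite tl in W; rewrite tts' tl in W'.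
  (* One component of the tuple has reduced, so the two substitutions differ by at most one step at
     each variable. *)
  apply: joinable_arg_subst W W' _ wb => x.
  rewrite /inst /cat_env (one_step_size H); case: ltnP => _; last by left.
  exact: one_step_nth H.
move=> sl W tl wb st; have [ws wu tu] := W; have E := @ext_lift l n Gam.
have wb' := wt_rename E wb.
have [T _] := wt_contract sl wb W tl.
case: (step_inv st) => [[? []]//|[[un ->]|[s' st' ->]|[u' st' ->]]].
(* Contracting the inner redex [Let n s u] after the outer one yields the same term. *)
- rewrite /= -(@contract_contract _ _ _ b s _ sl un);
  apply: (@joinable_arg_step false _ _ _ T).
  exact: S_beta.
(* [s] is in LT, so the step in it is not a root expansion and is allowed with flag [false], as the
   induction hypothesis requires. *)
- have st0 : step false (ext n Gam) s s' by apply: LT_step st';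
  rewrite /isLT (sl : arity s = _).
  have [T' J _] := IHs _ _ _ sl ws tl wb' st0.
  apply: joinable_joinable_arg => //=; apply: joinable_Let => //.
  exact: joinable_arg_refl.
- by apply: (@joinable_arg_step false _ _ _ T); apply: S_arg.
Qed.

(** If [s'] is outside LT, expanding it closes the peak; if it is in LT, beta removes the expansion.
    Under a [Let], the expansion is removed first and the step from [s] is then replayed. *)
Lemma joinable_arg_eta Gam s l s' : wt Gam s ->
  tyof Gam s = Tens l -> ~~ isLT s -> step false Gam s s' ->
  joinable_arg Gam (eta_expand l s) s'.
Proof.
move=> w tl ns st; have [w' t'] := wt_step w st.
have [T ET] := wt_step w (@S_eta true _ _ _ isT tl ns).
split; first by rewrite ET.
  case LTs': (isLT s').
    exists s'; last exact: rt_refl.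
    apply: (@rt_trans _ _ _ (eta_expand l s')); apply: rt_step;
      first exact: S_arg.
    by apply: step_eta_LT; rewrite // t'.
  exists (eta_expand l s'); apply: rt_step; first exact: S_arg.
  by constructor; rewrite ?LTs' ?t'.
move=> l' c; rewrite ET tl => -[<-].
exists (Let l c s'); last exact: rt_refl.
apply: (@rt_trans _ _ _ (Let l c s)); apply: rt_step; last exact: S_arg.
rewrite -[X in step _ _ _ X]contract_eta_expand; apply: S_beta.
by rewrite /= size_map size_iota.
Qed.

Lemma one_step_peak Gam ss ss1 ss2 :
  List.Forall id (map (wt Gam) ss) ->
  List.Forall (fun s => forall s1 s2, wt Gam s ->
    step true Gam s s1 -> step true Gam s s2 -> joinable true Gam s1 s2) ss ->
  one_step (step true Gam) ss ss1 -> one_step (step true Gam) ss ss2 ->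
  joinables Gam ss1 ss2.
Proof.
move=> + + H; move: ss2; elim: ss ss1 / H =>
  [s s1 ss st1|s ss ss1 sts1 IH] ss2 /= H1 H2 H3.
all: have [ws wss] := Forall_consP H1; have [Hs Hss] :=
  Forall_consP H2 => {H1 H2}.
all: inversion H3 as [? s2 ? st2|? ? ss2' sts2]; subst=> {H3}.
- apply: joinables_cons; first exact: Hs ws st1 st2.
  exact: joinables_refl.
- exists (s1 :: ss2'); apply: rt_step; by constructor.
- exists (s2 :: ss1); apply: rt_step; by constructor.
- apply: joinables_cons; first exact: joinable_refl.
  exact: IH.
Qed.

Lemma local_confluence Gam s e1 e2 s1 s2 : wt Gam s ->
  step e1 Gam s s1 -> step e2 Gam s s2 -> joinable_arg Gam s1 s2.
Proof.
(* Peaks with a root expansion are treated once for all shapes of [u]; two root expansions agree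
   because [tyof] fixes the annotation. Two steps with flag [false] remain. *)
have reduce G u : (forall u1 u2, step false G u u1 -> step false G u u2 ->
      joinable_arg G u1 u2) -> wt G u ->
    forall f1 f2 u1 u2, step f1 G u u1 -> step f2 G u u2 -> joinable_arg G u1 u2.
  move=> H w f1 f2 u1 u2 /step_eta_or_false[st1|[l1 [tl1 n1 ->]]]
    /step_eta_or_false[st2|[l2 [tl2 n2 ->]]].
  - exact: H.
  - by apply/joinable_arg_sym/joinable_arg_eta.
  - exact: joinable_arg_eta.
  - by move: tl2; rewrite tl1 => -[->]; apply: joinable_arg_refl.
elim/term_ind_nested: s Gam e1 e2 s1 s2 =>
  [x|ss IH|l b t IHb IHt|l a f ss IH] Gam e1 e2 s1 s2 w;
  apply: (reduce _ _ _ w) => {e1 e2 s1 s2} s1 s2 st1 st2;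
  have [w1 E1] := wt_step w st1; have [w2 E2] := wt_step w st2.
- by case: (step_inv st1) => [[? []]|].
- case: (step_inv st1) => [[? []]//|[ss1 H1 D1]].
  case: (step_inv st2) => [[? []]//|[ss2 H2 D2]]; subst.
  apply: joinable_joinable_arg; first by rewrite E1.
  apply/joinables_Tup/(one_step_peak w _ H1 H2).
  by apply: Forall_imp IH => u IHu u1 u2 wu /IHu H /H [].
- have [wb wt_t tl] := w.
  case: (step_inv st1) => [[? []]//|[[tk D1]|[b1 B1 D1]|[t1 T1 D1]]];
  case: (step_inv st2) => [[? []]//|[[tk' D2]|[b2 B2 D2]|[t2 T2 D2]]]; subst.
  + exact: joinable_arg_refl.
  + apply: joinable_arg_stepr (S_beta _ _ _ tk) => //.
    exact: joinable_arg_contract_body B2.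
  + apply: (joinable_arg_stepr _ (joinable_arg_contract_arg tk wt_t tl wb T2))
    => //.
    by apply: S_beta; apply: arity_step T2.
  + apply/joinable_arg_sym/(joinable_arg_stepr _ (joinable_arg_contract_body
    tk' wt_t tl wb B1)) => //.
    exact: S_beta.
  + apply: joinable_joinable_arg; first by rewrite E1.
    apply: joinable_Let => //; last exact: joinable_arg_refl.
    by have [] := IHb _ _ _ _ _ wb B1 B2.
  + apply: joinable_joinable_arg; first by rewrite E1.
    exists (Let l b1 t2); apply: rt_step; [exact: S_arg|exact: S_body].
  + apply/joinable_arg_sym/(joinable_arg_stepr _ (joinable_arg_contract_arg tk'
    wt_t tl wb T1)) => //.
    by apply: S_beta; apply: arity_step T1.
  + apply: joinable_joinable_arg; first by rewrite E1.
    exists (Let l b2 t1); apply: rt_step; [exact: S_body|exact: S_arg].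
  + apply: joinable_joinable_arg; first by rewrite E1.
    apply: joinable_Let; last exact: IHt wt_t T1 T2.
      by have [_ ->] := wt_step wt_t T1.
    exact: joinable_refl.
- case: (step_inv st1) => [[? []]//|[ss1 H1 D1]].
  case: (step_inv st2) => [[? []]//|[ss2 H2 D2]]; subst.
  apply: joinable_joinable_arg; first by rewrite E1.
  have [wss _] := w; apply/joinables_App/(one_step_peak wss _ H1 H2).
  by apply: Forall_imp IH => u IHu u1 u2 wu /IHu H /H [].
Qed.

End Reduction.

(** * Subject reduction *)

Scheme typing_min := Minimality for typing Sort Prop
  with typings_min := Minimality for typings Sort Prop.
Combined Scheme typing_typings_ind from typing_min, typings_min.

Section Typing.
Variable R : rep_sig.
Implicit Types (s t u b c : term R) (ss ts : seq (term R)).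
Implicit Types (g h d e : cxt R) (a : rty R) (l : seq (rty R)).
Implicit Types (Gam Del : nat -> rty R).

Lemma typing_inv g s a : typing g s a ->
  match s with
  | Var x => g = [:: (x, a)]
  | Tup ss => exists l, [/\ a = Tens l, typings g ss l & distinct g]
  | App l b _ ss => [/\ a = b, typings g ss l & distinct g]
  | Let l s t => exists d e d',
      [/\ g = d ++ e ++ d', typing e t (Tens l),
          typing (shift (size l) d ++ bound l ++ shift (size l) d') s a &
          distinct g]
  end.
Proof.
case: g s a / => [x a|l b f g ss H D|l g ss H D|l b d g d' s t H1 H2 D] //.
  by exists l.
by exists d, g, d'.
Qed.

Lemma typing_distinct g s a : typing g s a -> distinct g.
Proof. by case: g s a /. Qed.

Definition rename_cxt (r : nat -> nat) g : cxt R := [seq (r p.1, p.2) | p <- g].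

Lemma dom_rename_cxt r g : map fst (rename_cxt r g) = map r (map fst g).
Proof. by rewrite -!map_comp. Qed.

Lemma dom_bound l : map fst (bound l) = iota 0 (size l).
Proof. by rewrite -/(unzip1 _) unzip1_zip // size_iota. Qed.

Lemma distinct_rename r g : injective r -> distinct (rename_cxt r g) = distinct g.
Proof. by move=> ri; rewrite /distinct dom_rename_cxt map_inj_uniq. Qed.

Lemma distinct_cat g g' : distinct (g ++ g') ->
  distinct g /\ distinct g'.
Proof. by rewrite /distinct map_cat cat_uniq => /and3P[]. Qed.

Lemma distinct_catCA d g d' : distinct (d ++ g ++ d') = distinct (g ++ d ++ d').
Proof. by rewrite /distinct !map_cat uniq_catCA. Qed.

Lemma distinct_bound l : distinct (bound l).
Proof. by rewrite /distinct dom_bound iota_uniq. Qed.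

Lemma distinct_under l d d' : distinct (d ++ d') ->
  distinct (shift (size l) d ++ bound l ++ shift (size l) d').
Proof.
rewrite distinct_catCA -(distinct_rename _ (@addnI (size l))) => D.
have -> : shift (size l) d ++ shift (size l) d' = rename_cxt (addn (size l)) (d
  ++ d').
  by rewrite [RHS]map_cat.
rewrite /distinct map_cat cat_uniq -/(distinct _) distinct_bound -/(distinct _) D.
rewrite dom_rename_cxt dom_bound andbT; apply/hasPn => _ /mapP[x _ ->].
rewrite mem_iota; lia.
Qed.

Lemma bound_Forall l :
  List.Forall (fun p => p.1 < size l /\ nth (Tens [::]) l p.1 = p.2) (bound l).
Proof.
rewrite /bound.
suff H m : List.Forall (fun p => m <= p.1 < m + size l /\
    nth (Tens [::]) l (p.1 - m) = p.2) (zip (iota m (size l)) l).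
  by apply: Forall_imp (H 0) => -[i a] /=; rewrite subn0.
elim: l m => [|a l IH] m /=; constructor.
  by rewrite /= subnn; split=> //; lia.
apply: Forall_imp (IH m.+1) => -[i c] /= [im <-]; split; first lia.
by have -> : i - m = (i - m.+1).+1 by lia.
Qed.

Lemma rename_shift k r g :
  rename_cxt (lift_ren k r) (shift k g) = shift k (rename_cxt r g).
Proof.
rewrite /rename_cxt /shift -!map_comp; apply: eq_map => p /=.
by rewrite /lift_ren ltnNge leq_addr /= addKn.
Qed.

Lemma rename_bound l r : rename_cxt (lift_ren (size l) r) (bound l) = bound l.
Proof.
rewrite -[RHS]map_id; apply: eq_map_Forall; apply: Forall_imp (bound_Forall l).
by move=> [i a] /= [il _]; rewrite /lift_ren il.
Qed.

Lemma typing_typings_rename :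
  (forall g s a, typing g s a -> forall r, injective r ->
     typing (rename_cxt r g) (rename r s) a) /\
  (forall g ss l, typings g ss l -> forall r, injective r ->
     typings (rename_cxt r g) (map (rename r) ss) l).
Proof.
apply: typing_typings_ind => /=.
- by move=> x a r _; apply: T_Var.
- by move=> l b f g ss _ IH D r ri; apply: T_App (IH r ri) _;
  rewrite distinct_rename.
- by move=> l g ss _ IH D r ri; apply: T_Tup (IH r ri) _; rewrite distinct_rename.
- move=> l b d g d' s t _ IH1 _ IH2 D r ri.
  have D' : distinct (rename_cxt r (d ++ g ++ d')) by rewrite distinct_rename.
  rewrite /rename_cxt !map_cat in D' *; apply: T_Let (IH1 r ri) _ D'.
  have := IH2 _ (@lift_ren_inj (size l) r ri).
  by rewrite {1}/rename_cxt !map_cat -!/(rename_cxt _ _) !rename_shift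
    rename_bound.
- by move=> r _; apply: T_nil.
- move=> g g' s ss a l _ IH1 _ IH2 r ri; rewrite /rename_cxt map_cat.
  by apply: T_cons; [apply: IH1|apply: IH2].
Qed.

Lemma typing_rename r g s a : injective r -> typing g s a ->
  typing (rename_cxt r g) (rename r s) a.
Proof. by move=> ri /(proj1 typing_typings_rename); apply. Qed.

(** Link between a linear context and the total environments above: only the names declared in [g]
    are constrained. *)
Definition compat Gam g := List.Forall (fun p => Gam p.1 = p.2) g.

Lemma compat_shift Gam l g : compat Gam g ->
  compat (ext l Gam) (shift (size l) g).
Proof.
move=> H; apply/Forall_map; apply: Forall_imp H => -[x a] /= <-.
exact: cat_env_addn.
Qed.

Lemma compat_bound Gam l : compat (ext l Gam) (bound l).
Proof.
by apply: Forall_imp (bound_Forall l) => -[i a] /= [il]; rewrite /ext /cat_env il.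
Qed.

Lemma typing_typings_wt :
  (forall g s a, typing g s a -> forall Gam, compat Gam g ->
     wt Gam s /\ tyof Gam s = a) /\
  (forall g ss l, typings g ss l -> forall Gam, compat Gam g ->
     List.Forall id (map (wt Gam) ss) /\ map (tyof Gam) ss = l).
Proof.
apply: typing_typings_ind => /=.
- by move=> x a Gam /Forall_consP[].
- by move=> l b f g ss _ IH _ Gam /IH.
- by move=> l g ss _ IH _ Gam /IH[? ->].
- move=> l b d g d' s t _ IH1 _ IH2 _ Gam /Forall_cat[Cd /Forall_cat[/IH1[wt_t
  tt] Cd']].
  have [|ws ts] := IH2 (ext l Gam); last by [].
  apply/Forall_cat; split; first exact: compat_shift.
  apply/Forall_cat; split; [exact: compat_bound|exact: compat_shift].
- by move=> Gam _; split=> //; constructor.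
- move=> g g' s ss a l _ IH1 _ IH2 Gam /Forall_cat[/IH1[ws ts] /IH2[wss tss]].
  by split; [constructor|rewrite ts tss].
Qed.

Lemma typing_wt Gam g s a : compat Gam g -> typing g s a ->
  wt Gam s /\ tyof Gam s = a.
Proof. by move=> C /(proj1 typing_typings_wt); apply. Qed.

Lemma flatten_shift (gam gam' : nat * rty R -> cxt R) k g :
  (forall p, gam' (k + p.1, p.2) = shift k (gam p)) ->
  flatten (map gam' (shift k g)) = shift k (flatten (map gam g)).
Proof.
by move=> E; elim: g => //= p g IH; rewrite E IH /shift map_cat.
Qed.

(** [gam] gives each declaration the context of the term substituted for it. Flattening in the order
    of [g] follows the ordered splittings of the typing rules, so contexts are never permuted. *)
Lemma typing_typings_subst :
  (forall g s a, typing g s a -> forall sig (gam : nat * rty R -> cxt R),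
     List.Forall (fun p => typing (gam p) (sig p.1) p.2) g ->
     distinct (flatten (map gam g)) ->
     typing (flatten (map gam g)) (subst sig s) a) /\
  (forall g ss l, typings g ss l -> forall sig (gam : nat * rty R -> cxt R),
     List.Forall (fun p => typing (gam p) (sig p.1) p.2) g ->
     distinct (flatten (map gam g)) ->
     typings (flatten (map gam g)) (map (subst sig) ss) l).
Proof.
apply: typing_typings_ind => /=.
- by move=> x a sig gam /Forall_consP[H _] _; rewrite cats0.
- move=> l b f g ss _ IH _ sig gam H D; apply: T_App (D); exact: IH.
- move=> l g ss _ IH _ sig gam H D; apply: T_Tup (D); exact: IH.
- move=> l b d g d' s t _ IH1 _ IH2 _ sig gam /Forall_cat[Hd /Forall_cat[Hg Hd']].
  rewrite !map_cat !flatten_cat => D.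
  (* A bound declaration is its own context, which needs its type; hence [gam] takes declarations
     rather than names. *)
  pose gam' (p : nat * rty R) :=
    if p.1 < size l then [:: p] else shift (size l) (gam (p.1 - size l, p.2)).
  have E p : gam' (size l + p.1, p.2) = shift (size l) (gam p).
    by rewrite /gam' /= ltnNge leq_addr /= addKn -surjective_pairing.
  have Eb : flatten (map gam' (bound l)) = bound l.
    rewrite -[RHS](flatten_seq1 (bound l)); congr flatten; apply: eq_map_Forall.
    by apply: Forall_imp (bound_Forall l) => p [pl _]; rewrite /gam' pl.
  have D1 : distinct (flatten (map gam d) ++ flatten (map gam d')).
    by move: D; rewrite distinct_catCA => /distinct_cat[].
  have Hsh e : List.Forall (fun p => typing (gam p) (sig p.1) p.2) e ->
      List.Forall (fun p => typing (gam' p) (lift_sub (size l) sig p.1) p.2)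
        (shift (size l) e).
    move=> H; apply/Forall_map; apply: Forall_imp H => p H /=.
    rewrite E /lift_sub ltnNge leq_addr /= addKn.
    by apply: typing_rename H; apply: addnI.
  apply: T_Let (D).
    apply: IH1 Hg _; by move: D; rewrite distinct_catCA => /distinct_cat[].
  have := IH2 (lift_sub (size l) sig) gam'.
  rewrite !map_cat !flatten_cat !(flatten_shift _ E) Eb; apply;
    last exact: distinct_under.
  apply/Forall_cat; split; first exact: Hsh.
  apply/Forall_cat; split; last exact: Hsh.
  apply: Forall_imp (bound_Forall l) => -[i a] /= [il _].
  rewrite /gam' /lift_sub /= il; exact: T_Var.
- by move=> *; apply: T_nil.
- move=> g g' s ss a l _ IH1 _ IH2 sig gam /Forall_cat[H1 H2].
  rewrite map_cat flatten_cat => D; have [D1 D2] := distinct_cat D.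
  by apply: T_cons; [apply: IH1|apply: IH2].
Qed.

Lemma typings_flatten g ts l : typings g ts l -> exists gs : seq (cxt R),
  [/\ g = flatten gs, size gs = size l, size ts = size l & forall i, i < size l ->
   typing (nth [::] gs i) (nth (Var 0) ts i) (nth (Tens [::]) l i)].
Proof.
elim=> [|{}g g' s ss a {}l H _ [gs [-> S1 S2 IH]]]; first by exists [::].
exists (g :: gs); split=> //=; rewrite ?S1 ?S2 //.
by case=> [|i] //=; rewrite ltnS; apply: IH.
Qed.

Lemma typing_contract d e d' l b t a : typing e t (Tens l) -> isLT t ->
  typing (shift (size l) d ++ bound l ++ shift (size l) d') b a ->
  distinct (d ++ e ++ d') -> typing (d ++ e ++ d') (contract (size l) b t) a.
Proof.
elim/term_ind_nested: t d e d' b a => //= [ts _|n s u IHs _] d e d' b a.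
  move=> /typing_inv[_ [[<-] /typings_flatten[gs [-> Sg St Hg]] _]] _ Hb D.
  (* A bound variable receives the context of its component of the tuple, an outer one its own
     declaration, unshifted. *)
  pose gam (p : nat * rty R) :=
    if p.1 < size l then nth [::] gs p.1 else [:: (p.1 - size l, p.2)].
  have Es h : flatten (map gam (shift (size l) h)) = h.
    rewrite -[RHS](flatten_seq1 h) -map_comp; congr flatten;
      apply: eq_map => p /=.
    by rewrite /gam /= ltnNge leq_addr /= addKn -surjective_pairing.
  have Eb : flatten (map gam (bound l)) = flatten gs.
    congr flatten; rewrite -[RHS](mkseq_nth [::]) Sg /mkseq -dom_bound -map_comp.
    apply: eq_map_Forall; apply: Forall_imp (bound_Forall l) => p [pl _].
    by rewrite /gam /= pl.
  have Hs h : List.Forall (fun p =>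
    typing (gam p) (inst ts p.1) p.2) (shift (size l) h).
    apply/Forall_map; elim: h => [|p h IH]; constructor=> //.
    by rewrite /gam /inst /cat_env St /= ltnNge leq_addr /= addKn; apply: T_Var.
  have := (proj1 typing_typings_subst) _ _ _ Hb (inst ts) gam.
  rewrite !map_cat !flatten_cat !Es Eb; apply=> //.
  apply/Forall_cat; split=> //; apply/Forall_cat; split=> //.
  apply: Forall_imp (bound_Forall l) => p [pl <-].
  by rewrite /gam /inst /cat_env St pl; apply: Hg.
move=> /typing_inv[e1 [g [e2 [-> Hu Hs _]]]] sl Hb D.
(* When the [Let] on [u] moves outwards, the parts [e1] and [e2] of the context of the argument stay
   under its binder and are joined there by [d] and [d']. *)
move: (D); rewrite -!catA [d ++ _]catA => D'; rewrite -!catA [d ++ _]catA.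
apply: T_Let Hu _ (D').
have -> : shift (size n) (d ++ e1) ++ bound n ++ shift (size n) (e2 ++ d') =
    shift (size n) d ++ (shift (size n) e1 ++ bound n ++ shift (size n) e2)
      ++ shift (size n) d' by rewrite /shift !map_cat !catA.
apply: IHs => //.
  have := typing_rename (@lift_ren_inj (size l) _ (@addnI (size n))) Hb.
  by rewrite /rename_cxt !map_cat -!/(rename_cxt _ _) !rename_shift rename_bound.
have := @distinct_under n (d ++ e1) (e2 ++ d').
rewrite /shift !map_cat -!catA; apply.
by move: D'; rewrite distinct_catCA => /distinct_cat[_]; rewrite -!catA.
Qed.

Lemma typing_eta_expand g l s :
  typing g s (Tens l) -> typing g (eta_expand l s) (Tens l).
Proof.
move=> H; rewrite -[g]cats0; apply: (@T_Let _ _ _ [::]) (H) _ _.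
  rewrite cats0 /=; apply: T_Tup; last exact: distinct_bound.
  rewrite /bound; move: 0 => m {H}; elim: l m => [|a l IH] m /=;
    first exact: T_nil.
  by apply: (@T_cons _ [:: (m, a)]); [apply: T_Var|apply: IH].
by rewrite cats0; apply: typing_distinct H.
Qed.

Lemma typings_one_step Gam g ss ss' l :
  compat Gam g -> typings g ss l -> one_step (step true Gam) ss ss' ->
  List.Forall (fun s => forall g s' a, compat Gam g -> typing g s a ->
    step true Gam s s' -> typing g s' a) ss ->
  typings g ss' l.
Proof.
move=> + H; elim: H ss' => [|{}g g' s {}ss a {}l H1 H2 IH] ss' C H;
  inversion H; subst;
  move=> /Forall_consP[H3 H4]; have [C1 C2] := proj1 Forall_cat C.
  by apply: T_cons H2; apply: H3 H5.
by apply: T_cons => //; apply: IH.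
Qed.

Lemma typing_step Gam (e : bool) g s s' a : compat Gam g -> typing g s a ->
  step e Gam s s' -> typing g s' a.
Proof.
have eta_case G f u l a' : compat G f -> typing f u a' -> tyof G u = Tens l ->
    typing f (eta_expand l u) a'.
  move=> C H tu; have [_ E] := typing_wt C H; move: H; rewrite -E tu.
  exact: typing_eta_expand.
elim/term_ind_nested: s Gam e g s' a =>
  [x|ss IH|l s t IHs IHt|l a' f ss IH] Gam e g s' a C H st.
- by case: (step_inv st) => [[l [_ tl _ ->]]|//]; apply: eta_case tl.
- case: (step_inv st) => [[l [_ tl _ ->]]|[ss' H' ->]]; first exact: eta_case tl.
  have [l [-> Hss D]] := typing_inv H; apply: T_Tup (D).
  by apply: typings_one_step C Hss H' _; apply: Forall_imp IH => u IHu *;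
    apply: IHu; eauto.
- case: (step_inv st) => [[l' [_ tl _ ->]]|]; first exact: eta_case tl.
  have [d [h [d' [E Ht Hs D]]]] := typing_inv H; subst g.
  have [Cd /Forall_cat[Ch Cd']] := proj1 Forall_cat C.
  have [wt_t tt] := typing_wt Ch Ht.
  case=> [[tk ->]|[b' H' ->]|[t' H' ->]].
  + by apply: typing_contract => //; rewrite /isLT tk.
  + apply: T_Let Ht _ D; apply: IHs H' => //.
    apply/Forall_cat; split; first exact: compat_shift.
    apply/Forall_cat; split; [exact: compat_bound|exact: compat_shift].
  + by apply: T_Let D => //; apply: IHt H'.
- case: (step_inv st) => [[l' [_ tl _ ->]]|[ss' H' ->]]; first exact: eta_case tl.
  have [E Hss D] := typing_inv H; subst a; apply: T_App (D).
  by apply: typings_one_step C Hss H' _; apply: Forall_imp IH => u IHu *;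
    apply: IHu; eauto.
Qed.

End Typing.

(** * Comparison of the two presentations of the reduction *)

Section RepStep.
Variable R : rep_sig.
Implicit Types (s t u b c : term R) (ss ts : seq (term R)) (C E L : ctx R).
Implicit Types (g h d : cxt R) (a : rty R) (l : seq (rty R)).
Implicit Types (Gam Del : nat -> rty R).

Lemma compat_under Gam l g :
  compat Gam g -> compat (ext l Gam) (bound l ++ shift (size l) g).
Proof. by move=> C; apply/Forall_cat; split;
  [apply: compat_bound|apply: compat_shift]. Qed.

Lemma one_step_cat (P : term R -> term R -> Prop) ss s s' ss' :
  P s s' -> one_step P (ss ++ s :: ss') (ss ++ s' :: ss').
Proof. by move=> H; elim: ss => [|t ss IH]; constructor. Qed.

Lemma arity_fill L ts : is_L L -> arity (fill L (Tup ts)) = Some (size ts).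
Proof. by elim: L. Qed.

Lemma beta_step e Gam s s' : beta s s' -> step e Gam s s'.
Proof.
case=> C {}s {}s' [l b L ts LL E].
elim: C e Gam => /= [|ss C IH ss'|l' C IH t|l' t C IH|l' a f ss C IH ss'] e Gam.
- rewrite -contract_fill // E; apply: S_beta; by rewrite arity_fill // E.
- by apply: S_tup; apply: one_step_cat.
- exact: S_body.
- exact: S_arg.
- by apply: S_app; apply: one_step_cat.
Qed.

Lemma eta_fill_step (e : bool) Gam g E s l h : compat Gam g -> is_E E ->
  e || ~~ is_hole E -> List.incl h (hole_scope E g) -> typing h s (Tens l) ->
  ~ LT s -> step e Gam (fill E s) (fill E (eta_expand l s)).
Proof.
move=> + + + + H ns.
elim: E e Gam g =>
  /= [|ss E IH ss'|l' E IH t|l' t E IH|l' a f ss E IH ss'] e Gam g C EE eE I.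
- rewrite orbF in eE; apply: S_eta => //; last by apply/LTP.
  have [|//] := @typing_wt _ Gam _ _ _ _ H.
  apply/List.Forall_forall => p /I; move: p; exact/List.Forall_forall.
- by apply: S_tup; apply: one_step_cat; apply: IH I.
- by apply: S_body; apply: IH I => //; apply: compat_under.
- by case/andP: EE => nE EE; apply: S_arg; apply: IH I.
- by apply: S_app; apply: one_step_cat; apply: IH I.
Qed.

Lemma rep_step Gam g s t : compat Gam g -> rep g s t -> step true Gam s t.
Proof.
move=> C [/beta_step //|[E u l h EE I H n]]; exact: eta_fill_step C EE _ I H n.
Qed.

(** [rep] with the flag of [step]: excluding the empty context when [e] is [false] is what lets an
    induction pass under [CArg]. *)
Definition ctx_step (e : bool) g s s' : Prop :=
  exists C u u', [/\ s = fill C u, s' = fill C u' &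
    beta_root u u' \/
    exists l h, [/\ is_E C, e || ~~ is_hole C, List.incl h (hole_scope C g),
                    typing h u (Tens l) & ~ LT u /\ u' = eta_expand l u]].

Lemma one_step_split (P : term R -> term R -> Prop) (T : term R -> Prop)
    g ss ss' l :
  List.Forall T ss -> typings g ss l -> one_step P ss ss' ->
  exists ss1 u u' ss2 h a, [/\ ss = ss1 ++ u :: ss2, ss' = ss1 ++ u' :: ss2,
    P u u' /\ T u, typing h u a & List.incl h g].
Proof.
move=> + H; elim: H ss' => [|{}g g' s {}ss a {}l H1 H2 IH] ss' HT H;
  inversion H; subst;
  have [HT1 HT2] := Forall_consP HT.
  exists [::], s, s', ss, g, a; split=> //.
  by move=> p Hp; apply/In_cat; left.
have [ss1 [u [u' [ss2 [h [b [-> -> Pu Hh I]]]]]]] := IH _ HT2 H5.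
exists (s :: ss1), u, u', ss2, h, b; split=> //.
by move=> p /I Hp; apply/In_cat; right.
Qed.

Lemma arity_fillP t k : arity t = Some k ->
  exists L ts, [/\ is_L L, size ts = k & t = fill L (Tup ts)].
Proof.
elim/term_ind_nested: t => //= [ss _ [<-]|l s t IH _ /IH[L [ts [LL <- ->]]]].
  by exists CHole, ss.
by exists (CBody l L t), ts.
Qed.

(** [step] does not record a context for the expanded subterm, but eta needs one. The typing
    derivation supplies the part of the context allotted to that subterm, which is why [h] may be
    smaller than the scope [g]. *)
Lemma step_ctx_step (e : bool) Gam g h s s' a :
  compat Gam g -> typing h s a -> List.incl h g ->
  step e Gam s s' -> ctx_step e g s s'.
Proof.
have eta_case (f : bool) G g1 h1 u l a1 : f -> compat G g1 -> typing h1 u a1 ->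
  List.incl h1 g1 ->
    tyof G u = Tens l -> ~~ isLT u -> ctx_step f g1 u (eta_expand l u).
  move=> f1 C H I tu nu; exists CHole, u, (eta_expand l u); split=> //; right.
  exists l, h1; split=> //=; first by rewrite f1.
    have [|_ E] := @typing_wt _ G _ _ _ _ H; last by rewrite -tu E.
    apply/List.Forall_forall => p /I; move: p; exact/List.Forall_forall.
  by split=> //; apply/LTP.
elim/term_ind_nested: s e Gam g h s' a =>
  [x|ss IH|l b t IHb IHt|l a' f ss IH] e Gam g h s' a C H I st.
- by case: (step_inv st) => [[l [e1 tl n ->]]|//]; apply: eta_case C H I tl n.
- case: (step_inv st) => [[l [e1 tl n ->]]|[ss' H' ->]];
  first exact: eta_case C H I tl n.
  have [l [_ Hss D]] := typing_inv H.
  have [ss1 [u [u' [ss2 [h' [b [-> -> [Pu IHu] Hh' I']]]]]]] :=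
    one_step_split IH Hss H'.
  have [|Ct [v [v' [-> -> K]]]] := IHu _ _ _ _ _ _ C Hh' _ Pu;
    first by move=> p /I' /I.
  exists (CTup ss1 Ct ss2), v, v'; split=> //.
  case: K => [K|[l1 [h1 [? ? ? ? ?]]]]; [by left|right; exists l1, h1].
  by split=> //; apply: orbT.
- case: (step_inv st) => [[l1 [e1 tl n ->]]|]; first exact: eta_case C H I tl n.
  have [d [h1 [d' [E Ht Hb D]]]] := typing_inv H; subst h.
  move/inclP/Forall_cat: I => [/inclP Id /Forall_cat[/inclP Ih /inclP Id']].
  case=> [[tk ->]|[b' Hs ->]|[t' Hs ->]].
  + have [L [ts [LL st' E]]] := arity_fillP tk; rewrite E -st' contract_fill //.
    exists CHole, (Let l b (fill L (Tup ts))),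
      (fill L (beta_subst (depth L) ts b)).
    by split=> //; left; constructor.
  + have sh d0 : List.incl d0 g -> List.Forall (fun p =>
    List.In p (bound l ++ shift (size l) g)) (shift (size l) d0).
      move=> /inclP H0; apply/Forall_map; apply: Forall_imp H0 => p H0.
      by apply/In_cat; right; apply: (In_map (fun p => (size l + p.1, p.2))).
    have [|Ct [v [v' [-> -> K]]]] := IHb _ _ _ _ _ _ (compat_under l C) Hb _ Hs.
      apply/inclP/Forall_cat; split; first exact: sh.
      apply/Forall_cat; split; last exact: sh.
      by apply/List.Forall_forall => p Hp; apply/In_cat; left.
    exists (CBody l Ct t), v, v'; split=> //.
    case: K => [K|[l1 [h2 [? ? ? ? ?]]]]; [by left|right; exists l1, h2;
      split=> //].
    by rewrite orbT.
  + have [Ct [v [v' [-> -> K]]]] := IHt _ _ _ _ _ _ C Ht Ih Hs.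
    exists (CArg l b Ct), v, v'; split=> //.
    case: K => [K|[l1 [h2 [? nC ? ? ?]]]]; [by left|right; exists l1, h2;
      split=> //].
      by rewrite /= (nC : ~~ _).
    by rewrite orbT.
- case: (step_inv st) => [[l1 [e1 tl n ->]]|[ss' H' ->]];
  first exact: eta_case C H I tl n.
  have [_ Hss D] := typing_inv H.
  have [ss1 [u [u' [ss2 [h' [b [-> -> [Pu IHu] Hh' I']]]]]]] :=
    one_step_split IH Hss H'.
  have [|Ct [v [v' [-> -> K]]]] := IHu _ _ _ _ _ _ C Hh' _ Pu;
    first by move=> p /I' /I.
  exists (CApp f ss1 Ct ss2), v, v'; split=> //.
  case: K => [K|[l1 [h1 [? ? ? ? ?]]]]; [by left|right; exists l1, h1].
  by split=> //; apply: orbT.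
Qed.

Lemma step_rep Gam g s s' a : compat Gam g -> typing g s a ->
  step true Gam s s' -> rep g s s'.
Proof.
move=> C H st; have [//|Ct [u [u' [-> -> [B|[l [h [EE _ I Hu [n ->]]]]]]]]] :=
  step_ctx_step C H _ st.
  by left; constructor.
by right; apply: Eta EE I Hu n.
Qed.

Lemma typing_rep Gam g s s' a : compat Gam g -> typing g s a ->
  rep g s s' -> typing g s' a.
Proof. by move=> C H /(rep_step C); apply: typing_step C H. Qed.

Lemma steps_rep Gam g s s' a : compat Gam g -> typing g s a ->
  steps true Gam s s' -> clos_refl_trans _ (rep g) s s'.
Proof.
move=> C + /clos_rt_rt1n_iff H; elim: s s' / H => [s|s t u st _ IH] H.
  exact: rt_refl.
apply: (@rt_trans _ _ _ t); first by apply: rt_step; apply: step_rep H st.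
by apply: IH; apply: typing_step C H st.
Qed.

Definition cxt_fun g (x : nat) : rty R :=
  nth (Tens [::]) (map snd g) (index x (map fst g)).

(** Names are distinct, so the first occurrence found by [index] is the only one. *)
Lemma compat_cxt_fun g : distinct g -> compat (cxt_fun g) g.
Proof.
rewrite /compat /cxt_fun; elim: g => //= -[x a] g IH /andP[/= xg /IH H].
constructor; first by rewrite /= eqxx.
apply/List.Forall_forall => p Hp; have pg : p.1 \in map fst g.
  elim: g Hp {IH H xg} => //= q g IH [->|/IH]; rewrite inE ?eqxx // => ->.
  by rewrite orbT.
case: eqP xg => [->|_ _]; first by rewrite pg.
by move: p Hp {pg}; apply/List.Forall_forall.
Qed.
End RepStep.

(** * Termination *)

Section Measure.
Variable R : rep_sig.
Implicit Types (s t u b c : term R) (ss ts : seq (term R)).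
Implicit Types (g h d : cxt R) (a : rty R) (l : seq (rty R)).
Implicit Types (Gam Del : nat -> rty R) (rho : nat -> seq nat -> nat).

(* An expansion at [Tens l] creates a [Let], a tuple, and new places of the
   types in [l]: it costs 2 and is strictly cheaper than [weight (Tens l)]. *)
Fixpoint weight (A : Type) (a : ty A) : nat :=
  match a with
  | Atom _ => 0
  | Tens l => 3 + sumn (map (@weight A) l)
  end.

(** The bound variable [i] stands for the i-th component of the argument, so its values form the
    subtree of [v] below [i]. *)
Definition let_env k (v : seq nat -> nat) rho : nat -> seq nat -> nat :=
  cat_env k (fun i q => v (i :: q)) rho.

(* [val rho s [::]] bounds the number of [Let]s that [s] can leave around [b]
   when [Let l b s] is reduced, including those created by expanding the parts
   of [s]; the value at a path [i :: q] is the number at [q] for the i-th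
   component of the tuple that [s] stands for, which is what the variable [i]
   of [b] will be replaced with. *)
Fixpoint val rho s : seq nat -> nat :=
  match s with
  | Var x => rho x
  | Tup ss => fun p => if p is i :: q
      then nth 0 (map (fun s => val rho s q + ~~ isLT s) ss) i else 0
  | Let l b t => fun p =>
      val (let_env (size l) (val rho t) rho) b p
      + ~~ isLT b * (val rho t [::]).+1
      + (if p is [::] then (val rho t [::]).+1 else 0)
  | App _ _ _ _ => fun _ => 0
  end.

(** Value at a place where root expansion is allowed, such as a tuple component or the body of a
    [Let]: a pending expansion counts for one. *)
Definition val_body rho s p := val rho s p + ~~ isLT s.

(* A body outside LT can be expanded below its own [Let] and below each of the
   [val rho t [::]] ones that may replace it. *)
Fixpoint cost Gam rho s : nat :=
  match s with
  | Var _ => 0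
  | Tup ss | App _ _ _ ss =>
      (sumn (map (fun s => cost Gam rho s
                    + ~~ isLT s * weight (tyof Gam s)) ss)).+1
  | Let l b t =>
      (cost Gam rho t
       + cost (ext l Gam) (let_env (size l) (val rho t) rho) b
       + ~~ isLT b * (weight (tyof (ext l Gam) b) * (val rho t [::]).+1)).+1
  end.

(** The same correction for [cost]: a pending root expansion is charged the weight of the type. *)
Definition cost_body Gam rho s :=
  cost Gam rho s + ~~ isLT s * weight (tyof Gam s).

(** * Monotonicity of the measure and invariance under renaming *)

Lemma leq_nth_map (f f' : term R -> nat) ss i :
  List.Forall (fun s => f s <= f' s) ss ->
  nth 0 (map f ss) i <= nth 0 (map f' ss) i.
Proof. by move=> H; elim: H i => [|s {}ss Hs _ IH] [|i] /=. Qed.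

Lemma leq_sumn_map (f f' : term R -> nat) ss :
  List.Forall (fun s => f s <= f' s) ss ->
  sumn (map f ss) <= sumn (map f' ss).
Proof. by elim=> [|s {}ss Hs _ IH] //=; apply: leq_add. Qed.

Lemma leq_let_env k v v' rho rho' :
  (forall p, v p <= v' p) -> (forall x p, rho x p <= rho' x p) ->
  forall x p, let_env k v rho x p <= let_env k v' rho' x p.
Proof. by move=> Hv Hr x p; rewrite /let_env /cat_env; case: ifP. Qed.

Lemma leq_val rho rho' s : (forall x p, rho x p <= rho' x p) ->
  forall p, val rho s p <= val rho' s p.
Proof.
elim/term_ind_nested: s rho rho' => //= [ss IH|l s t IHs IHt] rho rho' H p.
  case: p => // i q; apply: leq_nth_map; apply: Forall_imp IH => s IHs.
  by rewrite leq_add2r IHs.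
have Ht := IHt _ _ H; have Hs := IHs _ _ (leq_let_env (size l) Ht H) p.
have := Ht [::]; case: (isLT s); case: p Hs => *; lia.
Qed.

Lemma leq_cost Gam rho rho' s : (forall x p, rho x p <= rho' x p) ->
  cost Gam rho s <= cost Gam rho' s.
Proof.
elim/term_ind_nested: s Gam rho rho' =>
  //= [ss IH|l s t IHs IHt|l a f ss IH] Gam rho rho' H.
- rewrite ltnS; apply: leq_sumn_map; apply: Forall_imp IH => s IHs.
  by rewrite leq_add2r IHs.
- have Ht := leq_val t H; rewrite ltnS; apply: leq_add.
    by apply: leq_add; [apply: IHt|apply: IHs; apply: leq_let_env].
  by do !apply: leq_mul => //; rewrite ltnS.
- rewrite ltnS; apply: leq_sumn_map; apply: Forall_imp IH => s IHs.
  by rewrite leq_add2r IHs.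
Qed.

(** Bound variables read only nonempty paths of the argument. For [s] in LT, the values of [s] and
    of [Let n s u] differ only at the empty path, so they give the same environment. *)
Lemma lift_let_env k v v' rho rho' r :
  (forall i p, v' (i :: p) = v (i :: p)) ->
  (forall x p, rho' (r x) p = rho x p) ->
  forall x p, let_env k v' rho' (lift_ren k r x) p = let_env k v rho x p.
Proof.
move=> Hv Hr x p; rewrite /let_env lift_ren_cat_env /cat_env.
by case: ifP => _ /=.
Qed.

Lemma val_rename rho rho' r s : (forall x p, rho' (r x) p = rho x p) ->
  forall p, val rho' (rename r s) p = val rho s p.
Proof.
elim/term_ind_nested: s rho rho' r => //= [ss IH|l s t IHs IHt] rho rho' r H p.
  case: p => // i q; rewrite -map_comp; congr nth; apply: eq_map_Forall.
  apply: Forall_imp IH => s IHs /=; by rewrite (IHs _ _ _ H) /isLT arity_rename.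
have Ht := IHt _ _ _ H; rewrite (IHs _ _ _ (lift_let_env (size l) (fun i p =>
  Ht (i :: p)) H)) Ht.
by rewrite /isLT arity_rename.
Qed.

Lemma cost_rename Gam Gam' rho rho' r s : (forall x, Gam' (r x) = Gam x) ->
  (forall x p, rho' (r x) p = rho x p) ->
  cost Gam' rho' (rename r s) = cost Gam rho s.
Proof.
elim/term_ind_nested: s Gam Gam' rho rho' r
  => //= [ss IH|l s t IHs IHt|l a f ss IH] Gam Gam' rho rho' r GG H.
- rewrite -map_comp; congr (sumn _).+1; apply: eq_map_Forall.
  apply: Forall_imp IH => s IHs /=.
  by rewrite (IHs _ _ _ _ _ GG H) /isLT arity_rename (tyof_rename _ GG).
- have Ht := val_rename t H; rewrite (IHt _ _ _ _ _ GG H) Ht.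
  have GG' x : ext l Gam' (lift_ren (size l) r x) = ext l Gam x.
    by rewrite /ext lift_ren_cat_env; apply: eq_cat_env.
  rewrite (IHs _ _ _ _ _ GG' (lift_let_env (size l) (fun i p => Ht (i :: p)) H)).
  by rewrite /isLT arity_rename (tyof_rename _ GG').
- rewrite -map_comp; congr (sumn _).+1; apply: eq_map_Forall.
  apply: Forall_imp IH => s IHs /=.
  by rewrite (IHs _ _ _ _ _ GG H) /isLT arity_rename (tyof_rename _ GG).
Qed.

(** * The measure under substitution *)

Lemma nLT_subst sig s : ~~ isLT (subst sig s) <= ~~ isLT s.
Proof. by rewrite /isLT; case E: (arity s) => [j|];
  rewrite ?(arity_subst _ E) ?leq_b1. Qed.

Lemma let_env_addn k v rho x : let_env k v rho (k + x) = rho x.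
Proof. exact: cat_env_addn. Qed.

Lemma val_lift_sub k v v' rho rho' sig :
  (forall p, v' p <= v p) -> (forall x p, val rho' (sig x) p <= rho x p) ->
  forall x p, val (let_env k v' rho') (lift_sub k sig x) p <= let_env k v rho x p.
Proof.
move=> Hv H x p; rewrite /lift_sub [X in _ <= X]/let_env /cat_env.
case: ltnP => xk /=; first by rewrite /let_env /cat_env xk.
rewrite (@val_rename rho') // => y q; by rewrite let_env_addn.
Qed.

(** Substitution never takes a term out of LT, so the counts of pending expansions can only drop. *)
Lemma val_subst rho rho' sig s :
  (forall x p, val rho' (sig x) p <= rho x p) ->
  forall p, val rho' (subst sig s) p <= val rho s p.
Proof.
elim/term_ind_nested: s rho rho' sig =>
  //= [ss IH|l s t IHs IHt] rho rho' sig H p.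
  case: p => // i q; rewrite -map_comp; apply: leq_nth_map.
  apply: Forall_imp IH => s IHs /=.
  by apply: leq_add; [apply: IHs|apply: nLT_subst].
have Ht := IHt _ _ _ H; have Hs := IHs _ _ _ (val_lift_sub (size l) Ht H) p.
apply: leq_add; last by case: p {Hs} => //; rewrite ltnS.
by apply: leq_add Hs _; apply: leq_mul; rewrite ?nLT_subst ?ltnS.
Qed.

(** This is where linearity enters: contexts are split among subterms, so the cost of [sig x] is
    added once per declaration. Its pending root expansion is already charged at the place of [x],
    since a variable is outside LT. *)
Lemma cost_subst_typings :
  (forall g s a, typing g s a -> forall Gam Del rho rho' sig,
     wt_sub Gam Del sig -> (forall x p, val rho' (sig x) p <= rho x p) ->
     cost Del rho' (subst sig s) <=
       cost Gam rho s + \sum_(x <- map fst g) cost Del rho' (sig x)) /\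
  (forall g ss l, typings g ss l -> forall Gam Del rho rho' sig,
     wt_sub Gam Del sig -> (forall x p, val rho' (sig x) p <= rho x p) ->
     sumn (map (cost_body Del rho') (map (subst sig) ss)) <=
       sumn (map (cost_body Gam rho) ss)
       + \sum_(x <- map fst g) cost Del rho' (sig x)).
Proof.
apply: typing_typings_ind => /=.
- by move=> x a Gam Del rho rho' sig _ _; rewrite big_seq1.
- by move=> l b f g ss _ IH _ Gam Del rho rho' sig W H; rewrite addSn ltnS;
  apply: IH.
- by move=> l g ss _ IH _ Gam Del rho rho' sig W H; rewrite addSn ltnS; apply: IH.
- move=> l b d g d' s t _ IHt _ IHs _ Gam Del rho rho' sig W H.
  have Ht := val_subst t H.
  have := IHt _ _ _ _ _ W H.
  have := IHs _ _ _ _ _ (wt_sub_lift l W) (val_lift_sub (size l) Ht H).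
  rewrite !map_cat !big_cat /= dom_bound.
  have Esh e : \sum_(x <- map fst (shift (size l) e)) cost (ext l Del)
       (let_env (size l) (val rho' (subst sig t)) rho') (lift_sub (size l) sig
         x) =
     \sum_(x <- map fst e) cost Del rho' (sig x).
    rewrite -map_comp !big_map; apply: eq_bigr => p _ /=.
    rewrite /lift_sub ltnNge leq_addr /= addKn; apply: cost_rename => x.
      exact: cat_env_addn.
    by move=> q; rewrite let_env_addn.
  (* The bound variables are sent to themselves, at cost 0. *)
  rewrite !Esh [\sum_(x <- iota _ _) _]big1_seq; last first.
    by move=> x; rewrite mem_iota /lift_sub add0n /= => ->.
  rewrite (tyof_subst _ (wt_sub_lift l W)).
  set cs := cost _ _ (subst _ s); set ct := cost _ _ (subst _ t).
  set X := ~~ isLT (subst _ s) * _; set Y := ~~ isLT s * _.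
  have XY : X <= Y.
    by rewrite /X /Y; apply: leq_mul (nLT_subst _ _) _;
      rewrite leq_mul2l ltnS Ht orbT.
  lia.
- by move=> Gam Del rho rho' sig _ _; rewrite big_nil.
- move=> g g' s ss a l _ IH1 _ IH2 Gam Del rho rho' sig W H.
  rewrite map_cat big_cat /=; have := IH1 _ _ _ _ _ W H;
    have := IH2 _ _ _ _ _ W H.
  have := leq_mul (nLT_subst sig s) (leqnn (weight (tyof Gam s))).
  by rewrite {3 5}/cost_body (tyof_subst _ W); lia.
Qed.

Lemma cost_subst g s a Gam Del rho rho' sig : typing g s a ->
  wt_sub Gam Del sig -> (forall x p, val rho' (sig x) p <= rho x p) ->
  cost Del rho' (subst sig s) <=
    cost Gam rho s + \sum_(x <- map fst g) cost Del rho' (sig x).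
Proof. by move=> H; apply: (proj1 cost_subst_typings) H _ _ _ _ _. Qed.

(** * The measure under contraction *)

Lemma nLT_contract k b t k' : arity t = Some k' ->
  ~~ isLT (contract k b t) <= ~~ isLT b.
Proof.
by rewrite /isLT => tk; case E: (arity b) => [j|];
  rewrite ?(arity_contract _ E tk) ?leq_b1.
Qed.

Lemma val_inst ts rho x p :
  val rho (inst ts x) p <= let_env (size ts) (val rho (Tup ts)) rho x p.
Proof.
rewrite /inst /let_env /cat_env; case: ltnP => // xt /=.
by rewrite (nth_map (Var 0)) // leq_addr.
Qed.

(** The [Let] of the redex disappears, so [val rho t [::]] replaces the successor that [val] of the
    redex contains. *)
Lemma val_contract k rho b t p : arity t = Some k ->
  val rho (contract k b t) p <=
    val (let_env k (val rho t) rho) b p + ~~ isLT b * val rho t [::]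
    + (if p is [::] then val rho t [::] else 0).
Proof.
elim/term_ind_nested: t rho b p => // [ts _|n s u IHs _] rho b p.
  move=> [<-] /=; apply: (leq_trans (val_subst _ (val_inst ts rho) p)).
  by rewrite -addnA leq_addr.
move=> sk; have LTs : isLT s by rewrite /isLT (sk : arity s = _).
pose ru := let_env (size n) (val rho u) rho.
(* Under the [Let] moved outwards, the variables of [b] keep their values, because [s] is in LT. *)
have E (c : term R) q : val (let_env k (val ru s) ru) (rename (lift_ren k (addn
  (size n))) c) q =
    val (let_env k (val rho (Let n s u)) rho) c q.
  apply: val_rename => x {}q; apply: lift_let_env => [i q'|y q'].
    by rewrite /= LTs /= !addn0.
  by rewrite /ru let_env_addn.
pose b' := rename (lift_ren k (addn (size n))) b.
have EL q : val rho (Let n s u) q =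
    val ru s q + (if q is [::] then (val rho u [::]).+1 else 0).
  by rewrite /= LTs /= addn0.
have EB : val rho (contract k b (Let n s u)) p = val ru (contract k b' s) p
    + ~~ isLT (contract k b' s) * (val rho u [::]).+1
    + (if p is [::] then (val rho u [::]).+1 else 0) by [].
have := leq_mul (@nLT_contract k b' s k sk) (leqnn (val rho u [::]).+1).
have := IHs ru b' p sk; rewrite E EL EB {EB EL E}.
have -> : isLT b' = isLT b by rewrite /isLT arity_rename.
rewrite mulnDr; case: p => [|i q]; lia.
Qed.

Lemma sum_uniq_leq k (F : nat -> nat) (xs : seq nat) : uniq xs ->
  (forall x, k <= x -> F x = 0) ->
  \sum_(x <- xs) F x <= \sum_(x <- iota 0 k) F x.
Proof.
move=> U F0; rewrite (bigID (fun x => x < k)) /= [X in _ + X]big1 ?addn0;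
  last first.
  by move=> x; rewrite -leqNgt => /F0.
rewrite [X in _ <= X](bigID (mem xs)) /= -[X in X <= _]addn0 leq_add //.
rewrite -[X in X <= _]big_filter -[X in _ <= X]big_filter (perm_big [seq i <-
  iota 0 k | i \in xs]) //.
apply: uniq_perm; rewrite ?filter_uniq ?iota_uniq // => x.
by rewrite !mem_filter mem_iota add0n andbC.
Qed.

(** Strictness comes from the tuple, whose own unit of cost vanishes. When [Let n s u] is crossed,
    the new body is charged its weight [(val rho u [::]).+1] times; added to the [val ru s [::]]
    times of the induction hypothesis, this is [val rho (Let n s u) [::]] times. *)
Lemma cost_contract g a Gam rho l b t :
  typing g b a -> wt (ext l Gam) b -> wt Gam t ->
  tyof Gam t = Tens l -> isLT t ->
  cost Gam rho (contract (size l) b t) <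
    cost Gam rho t + cost (ext l Gam) (let_env (size l) (val rho t) rho) b
    + ~~ isLT b * (weight (tyof (ext l Gam) b) * val rho t [::]).
Proof.
elim/term_ind_nested: t g Gam rho b => // [ts _|n s u IHs _] g Gam rho b Hb wb.
  move=> wts [tl] _; have W := wt_sub_inst wts; rewrite tl in W.
  have st : size l = size ts by rewrite -tl size_map.
  have := cost_subst Hb W (val_inst ts rho); rewrite st.
  have F0 x : size ts <= x -> cost Gam rho (inst ts x) = 0.
    by rewrite /inst /cat_env ltnNge => ->.
  (* Each name counts at most once, and names from [size ts] on are sent to variables, of cost 0;
     only the components of the tuple contribute. *)
  have := sum_uniq_leq (typing_distinct Hb) F0.
  have -> : \sum_(x <- iota 0 (size ts)) cost Gam rho (inst ts x) =
      sumn (map (cost Gam rho) ts).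
    rewrite sumnE big_map [RHS](big_nth (Var 0)) /index_iota subn0.
    rewrite !big_seq; apply: eq_bigr => x.
    by rewrite mem_iota add0n /inst /cat_env /= => ->.
  have : sumn (map (cost Gam rho) ts) <= sumn (map (cost_body Gam rho) ts).
    by apply: leq_sumn_map; apply/List.Forall_forall => x _; apply: leq_addr.
  have -> : val rho (Tup ts) [::] = 0 by [].
  have -> : cost Gam rho (Tup ts) = (sumn (map (cost_body Gam rho) ts)).+1 by [].
  rewrite [contract _ _ _]/= !muln0; lia.
move=> W tl' LT'; pose ru := let_env (size n) (val rho u) rho.
have [ws wu tu] : [/\ wt (ext n Gam) s, wt Gam u & tyof Gam u = Tens n] := W.
have tl : tyof (ext n Gam) s = Tens l := tl'.
have LTs' : isLT s := LT'; have sk := arity_tyof LTs' tl;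
  have G := @ext_lift R l n Gam.
pose b' := rename (lift_ren (size l) (addn (size n))) b.
have G' x q : let_env (size l) (val ru s) ru (lift_ren (size l) (addn (size n))
  x) q =
    let_env (size l) (val rho (Let n s u)) rho x q.
  apply: lift_let_env => [i q'|y q']; first by rewrite /= LTs' /= !addn0.
  by rewrite /ru let_env_addn.
have Ev : val rho (Let n s u) [::] = val ru s [::] + (val rho u [::]).+1.
  by rewrite /= LTs' /= addn0.
have Es : cost Gam rho (Let n s u) = (cost Gam rho u + cost (ext n Gam) ru s).+1.
  by rewrite /= LTs' /= addn0.
have Eb : cost Gam rho (contract (size l) b (Let n s u)) = (cost Gam rho u
    + cost (ext n Gam) ru (contract (size l) b' s)
    + ~~ isLT (contract (size l) b' s)
      * (weight (tyof (ext n Gam) (contract (size l) b' s)) * (val rho u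
        [::]).+1)).+1 by [].
have wb' : wt (ext l (ext n Gam)) b' := wt_rename G wb.
have := IHs _ (ext n Gam) ru _
  (typing_rename (@lift_ren_inj (size l) _ (@addnI (size n))) Hb) wb' ws tl LTs'.
rewrite -/b' Ev Es Eb; have [_ ->] := wt_contract sk wb' ws tl.
rewrite (cost_rename _ G G') (tyof_rename _ G) {G' Ev Es Eb wb'}.
have := leq_mul (@nLT_contract (size l) b' s _ sk)
  (leqnn (weight (tyof (ext l Gam) b) * (val rho u [::]).+1)).
have -> : isLT b' = isLT b by rewrite /isLT arity_rename.
rewrite !mulnDr; lia.
Qed.

(* The argument of a [Let] cannot be expanded at its root, so that [val] and
   [cost] of an argument are not charged for this expansion. *)
Definition decr_arg Gam rho s s' : Prop :=
  (forall p, val rho s' p <= val rho s p) /\ cost Gam rho s' < cost Gam rho s.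

Definition decr_body Gam rho s s' : Prop :=
  (forall p, val_body rho s' p <= val_body rho s p) /\ cost_body Gam rho s' <
    cost_body Gam rho s.

(** * Decrease of the measure along steps *)

Lemma decr_arg_decr_body e Gam rho s s' : wt Gam s -> step e Gam s s' ->
  decr_arg Gam rho s s' -> decr_body Gam rho s s'.
Proof.
move=> w st [Hv Hc]; have [_ E] := wt_step w st.
have LTs : ~~ isLT s' <= ~~ isLT s.
  by have := isLT_step _ st; case: isLT => [->|_] //; apply: leq_b1.
split=> [p|]; first exact: leq_add.
by rewrite /cost_body E -addSn leq_add // leq_mul2r LTs orbT.
Qed.

(** For the values, the pending expansion of [s] becomes an actual [Let] at the empty path, and at a
    path [i :: q] the pending expansion of the variable [i]. For the cost, the weight is traded for
    one [Let], one tuple and the weights of the components. *)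
Lemma decr_body_eta Gam rho s l : tyof Gam s = Tens l -> ~~ isLT s ->
  decr_body Gam rho s (eta_expand l s).
Proof.
move=> tl ns; split=> [p|].
  rewrite /val_body ns; case: p => [|i q]; first by rewrite /= !(addn0, mul0n,
    add0n) addn1.
  rewrite /= !addn0 -map_comp; case: (ltnP i (size l)) => il;
    last by rewrite nth_default ?size_map ?size_iota.
  by rewrite (nth_map 0) ?size_iota //= nth_iota // /let_env /cat_env il addn1.
have E : sumn (map (cost_body (ext l Gam) (let_env (size l) (val rho s) rho))
  (vars R (size l)))
    = sumn (map (@weight _) l).
  rewrite -[in RHS](tyof_vars Gam l) /vars -!map_comp; congr sumn.
  by apply: eq_map => x; rewrite /cost_body /= mul1n.
have -> : cost_body Gam rho (eta_expand l s) = (cost Gam rho s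
    + (sumn (map (cost_body (ext l Gam) (let_env (size l) (val rho s) rho))
      (vars R (size l)))).+1
    + 0).+1 + 0 by [].
rewrite E /cost_body tl ns [weight _]/=; lia.
Qed.

Lemma decr_body_list g ss l Gam rho ss' : compat Gam g -> typings g ss l ->
  List.Forall (fun s => forall g a s', compat Gam g -> typing g s a ->
    step true Gam s s' -> decr_body Gam rho s s') ss ->
  one_step (step true Gam) ss ss' ->
  (forall i q, nth 0 (map (val_body rho ^~ q) ss') i <= nth 0 (map (val_body
    rho ^~ q) ss) i) /\
  sumn (map (cost_body Gam rho) ss') < sumn (map (cost_body Gam rho) ss).
Proof.
move=> + H; elim: H ss' => [|{}g g' s {}ss a {}l Hs _ IH] ss' C HF st;
  inversion st as [? s1 ? st1|? ? ss1 st1]; subst=> {st};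
  have [HFs HFss] := Forall_consP HF; have [C1 C2] := proj1 Forall_cat C.
  have [Hv Hc] := HFs _ _ _ C1 Hs st1.
  by split=> [[|i] q|] //=; rewrite -addSn leq_add2r.
have [Hv Hc] := IH _ C2 HFss st1.
by split=> [[|i] q|] //=; rewrite -addnS leq_add2l.
Qed.

(** Adds the root expansion. It is stated for a single term so that it applies to the induction
    hypotheses of [step_decr_arg]. *)
Lemma decr_body_of_decr_arg u :
  (forall g a Gam rho u', compat Gam g -> typing g u a ->
     step false Gam u u' -> decr_arg Gam rho u u') ->
  forall g a Gam rho u', compat Gam g -> typing g u a ->
    step true Gam u u' -> decr_body Gam rho u u'.
Proof.
move=> H g a Gam rho u' C Hu st; have [w _] := typing_wt C Hu.
case: (step_eta_or_false st) => [st'|[l [tl n ->]]]; last exact: decr_body_eta.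
by apply: decr_arg_decr_body st _ => //; apply: H C Hu st'.
Qed.

Lemma step_decr_arg g s a Gam rho s' : compat Gam g -> typing g s a ->
  step false Gam s s' -> decr_arg Gam rho s s'.
Proof.
elim/term_ind_nested: s g a Gam rho s' =>
  [x|ss IH|l b t IHb IHt|l a' f ss IH] g a Gam rho s' C H st.
- by case: (step_inv st) => [[? []]|].
- case: (step_inv st) => [[? []]//|[ss' H' ->]].
  have [l [_ Hss _]] := typing_inv H.
  have [|Hv Hc] := decr_body_list (rho := rho) C Hss _ H'.
    by apply: Forall_imp IH => u IHu g1 a1 u' C1 H1;
      apply: decr_body_of_decr_arg C1 H1 => *; apply: IHu; eauto.
  by split=> [[|i q]|] //=; apply: Hv.
- have [wt_s _] := typing_wt C H; have [wb wt_t tl] := wt_s.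
  case: (step_inv st) => [[? []]//|].
  have [d [h [d' [E Ht Hb D]]]] := typing_inv H; subst g.
  have [Cd /Forall_cat[Ch Cd']] := proj1 Forall_cat C.
  case=> [[tk ->]|[b' Hs ->]|[t' Hs ->]].
  + have LTt : isLT t by rewrite /isLT tk.
    have := cost_contract rho Hb wb wt_t tl LTt.
    have Hv p := val_contract rho b p tk.
    split=> [p|].
      apply: (leq_trans (Hv p)) => /=; apply: leq_add; last by case: p.
      by rewrite leq_add2l leq_mul2l leqnSn orbT.
    rewrite /= mulnS; lia.
  + set ru := let_env (size l) (val rho t) rho.
    have Cb : compat (ext l Gam) (shift (size l) d ++ bound l ++ shift (size l)
      d').
      apply/Forall_cat; split; first exact: compat_shift.
      apply/Forall_cat; split; [exact: compat_bound|exact: compat_shift].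
    have [Hv Hc] := decr_body_of_decr_arg IHb ru Cb Hb Hs.
    have [_ E] := wt_step wb Hs.
    have LTb : ~~ isLT b' <= ~~ isLT b.
      by have := isLT_step _ Hs; case: isLT => [->|_] //; apply: leq_b1.
    split=> [p|] /=; rewrite -/ru.
      rewrite leq_add2r; have := Hv p; rewrite /val_body !mulnS.
      have := leq_mul LTb (leqnn (val rho t [::])); lia.
    (* One charge of the weight belongs to [cost_body] and decreases with it; the other [val rho t
       [::]] charges do not grow, because LT is stable. *)
    rewrite E; move: Hc; rewrite /cost_body E !mulnS !mulnDr.
    have := leq_mul LTb (leqnn (weight (tyof (ext l Gam) b) * val rho t [::]));
      lia.
  (* A smaller value of the argument lowers the environment of the body and the number of charges on
     it, so monotonicity suffices. *)
  + have [Hv Hc] := IHt _ _ _ rho _ Ch Ht Hs.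
    have Henv := @leq_let_env (size l) _ _ rho rho Hv (fun x p => leqnn _).
    split=> [p|] /=.
      apply: leq_add; last by case: p; rewrite ?ltnS.
      by apply: leq_add; [apply: leq_val|apply: leq_mul; rewrite ?ltnS].
    rewrite ltnS -addnA -addSn -[X in _ <= X]addnA leq_add //.
    by apply: leq_add; [apply: leq_cost|do !apply: leq_mul => //; rewrite ltnS].
- case: (step_inv st) => [[? []]//|[ss' H' ->]].
  have [_ Hss _] := typing_inv H.
  have [|Hv Hc] := decr_body_list (rho := rho) C Hss _ H'.
    by apply: Forall_imp IH => u IHu g1 a1 u' C1 H1;
      apply: decr_body_of_decr_arg C1 H1 => *; apply: IHu; eauto.
  by split.
Qed.
End Measure.

(** * Abstract rewriting *)

(** The invariant [P] will be typability in a fixed context, since local confluence is established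
    only for typed terms. *)
Lemma newman (A : Type) (red : A -> A -> Prop) (P : A -> Prop) :
  (forall x y, P x -> red x y -> P y) ->
  (forall x y z, P x -> red x y -> red x z ->
     exists v, clos_refl_trans A red y v /\ clos_refl_trans A red z v) ->
  forall x, SN red x -> P x -> confluent_at red x.
Proof.
move=> Pred wcr x; elim=> {}x _ IH Px t u.
move=> /clos_rt_rt1n_iff xt /clos_rt_rt1n_iff xu.
inversion xt as [|y t' xy yt]; subst.
  by exists u; split; [apply/clos_rt_rt1n_iff|apply: rt_refl].
inversion xu as [|z u' xz zu]; subst.
  by exists t; split; [apply: rt_refl|apply/clos_rt_rt1n_iff].
have [v [yv zv]] := wcr _ _ _ Px xy xz.
move/clos_rt_rt1n_iff: yt => yt; move/clos_rt_rt1n_iff: zu => zu.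
have [w [tw vw]] := IH _ xy (Pred _ _ Px xy) _ _ yt yv.
have [w' [uw' ww']] := IH _ xz (Pred _ _ Px xz) _ _ zu (rt_trans _ _ _ _ _ zv vw).
by exists w'; split=> //; apply: rt_trans tw ww'.
Qed.

Lemma SN_measure (A : Type) (red : A -> A -> Prop) (P : A -> Prop)
    (m : A -> nat) :
  (forall x y, P x -> red x y -> P y /\ m y < m x) -> forall x, P x -> SN red x.
Proof.
move=> H x; have [n] := ubnP (m x); elim: n x => [x|n IH x];
  first by rewrite ltn0.
rewrite ltnS => mx Px; constructor=> y /(H _ _ Px)[Py yx].
apply: IH Py; exact: leq_trans mx.
Qed.

Lemma SN_rep (R : rep_sig) (g : cxt R) a s : typing g s a -> SN (rep g) s.
Proof.
move=> H; have C := compat_cxt_fun (typing_distinct H).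
(* [cost_body], because the whole term may be expanded at its root. The values of the free variables
   are arbitrary: the decrease holds for every [rho]. *)
apply: (@SN_measure _ (rep g) (fun t => typing g t a)
  (cost_body (cxt_fun g) (fun _ _ => 0)) _ s H) => t u Ht /(rep_step C) st.
split; first exact: typing_step C Ht st.
by have [] := decr_body_of_decr_arg (fun g a Gam rho =>
  @step_decr_arg R g t a Gam rho) (fun _ _ => 0) C Ht st.
Qed.

Theorem theorem3p10 (R : rep_sig) :
  forall (g : cxt R) (a : rty R) (s : term R), typing g s a ->
    confluent_at (rep g) s /\ SN (rep g) s.
Proof.
move=> g a s H; have C := compat_cxt_fun (typing_distinct H).
split; last exact: SN_rep H.
apply: (@newman _ (rep g) (fun t => typing g t a)) (SN_rep H) H.
  by move=> t u; apply: typing_rep C.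
move=> t u v Ht tu tv; have [w _] := typing_wt C Ht.
(* At the root of the whole term, where expansion is allowed, the first form of joinability is the
   one needed. *)
have [_ [z uz vz] _] := local_confluence w (rep_step C tu) (rep_step C tv).
exists z; split.
  exact: steps_rep C (typing_rep C Ht tu) uz.
exact: steps_rep C (typing_rep C Ht tv) vz.
Qed.
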